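(* Let $\mathbb K$ be a field, $N\ge 2$ an integer, and let $\mathcal A=A(E,R)$ be an $N$-homogeneous algebra over $\mathbb K$. Then the ($N$-homogeneous) algebra $\mathbf{end}(\mathcal A)=\mathcal A^!\bullet\mathcal A=\mathbf{hom}(\mathcal A,\mathcal A)$ endowed with the coproduct $\Delta:\mathbf{end}(\mathcal A)\to\mathbf{end}(\mathcal A)\otimes\mathbf{end}(\mathcal A)$ becomes a bialgebra with counit $\varepsilon:\mathcal A^!\bullet\mathcal A\to\mathbb K$ induced by the duality $\varepsilon=\langle\cdot,\cdot\rangle:E^*\otimes E\to\mathbb K$, and $\delta:\mathcal A\to\mathbf{end}(\mathcal A)\otimes\mathcal A$ defines on $\mathcal A$ a structure of left $\mathbf{end}(\mathcal A)$-comodule.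
   Context: $\otimes$ is the tensor product over $\mathbb K$; algebras are unital associative. An $N$-homogeneous algebra is an algebra of the form $A(E,R)=T(E)/(R)$, where $E$ is a finite-dimensional $\mathbb K$-vector space, $R\subset E^{\otimes N}$ is a linear subspace, and $(R)$ is the two-sided ideal of the tensor algebra $T(E)$ generated by $R$. The dual of $A(E,R)$ is $A(E,R)^!=A(E^*,R^\perp)$, where $R^\perp\subset (E^{\otimes N})^*=E^{*\otimes N}$ is the annihilator of $R$. For vector spaces $E,E'$ let $\pi_N:E^{\otimes N}\otimes E'^{\otimes N}\to (E\otimes E')^{\otimes N}$ be the linear isomorphism $e_1\otimes\cdots\otimes e_N\otimes e'_1\otimes\cdots\otimes e'_N\mapsto (e_1\otimes e'_1)\otimes\cdots\otimes(e_N\otimes e'_N)$. Set $$A(E,R)\circ A(E',R')=A\big(E\otimes E',\ \pi_N(R\otimes E'^{\otimes N}+E^{\otimes N}\otimes R')\big),\qquad A(E,R)\bullet A(E',R')=A\big(E\otimes E',\ \pi_N(R\otimes R')\big).$$ For $\mathcal A=A(E,R)$, $\mathcal B=A(E',R')$ set $\mathbf{hom}(\mathcal A,\mathcal B)=\mathcal A^!\bullet\mathcal B$, which is generated by $E^*\otimes E'$. There are algebra homomorphisms $\delta:\mathcal B\to\mathbf{hom}(\mathcal A,\mathcal B)\otimes\mathcal A$ and, for $\mathcal C=A(E'',R'')$, $\Delta:\mathbf{hom}(\mathcal A,\mathcal C)\to\mathbf{hom}(\mathcal B,\mathcal C)\otimes\mathbf{hom}(\mathcal A,\mathcal B)$.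 They are obtained by composing morphisms of $N$-homogeneous algebras with values in $\mathbf{hom}(\mathcal A,\mathcal B)\circ\mathcal A$, respectively $\mathbf{hom}(\mathcal B,\mathcal C)\circ\mathbf{hom}(\mathcal A,\mathcal B)$, with the canonical injective algebra homomorphisms $\mathcal X\circ\mathcal Y\to\mathcal X\otimes\mathcal Y$ (sending a degree-one generator $x\otimes y$ to $x\otimes y$). On generators, with $(e_i)$ a basis of $E$ and $(e^i)$ its dual basis, $(e'_j)$ a basis of $E'$ and $(e'^j)$ its dual basis, they are given by $$\delta(e')=\sum_i (e^i\otimes e')\otimes e_i\quad(e'\in E'),\qquad \Delta(\omega\otimes e'')=\sum_j (e'^j\otimes e'')\otimes(\omega\otimes e'_j)\quad(\omega\in E^*,\ e''\in E'').$$ In the claim these are used with $\mathcal A=\mathcal B=\mathcal C$. *)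

(* Defs.v *)
(* MathComp, with classical logic from mathcomp.classical.boolp. *)
From HB Require Import structures.
From mathcomp Require Import all_boot all_order all_algebra.
From mathcomp Require Import ring_quotient generic_quotient.
From mathcomp Require Import boolp finmap monalg.
From mathcomp Require classical_sets.

Set Implicit Arguments.
Unset Strict Implicit.
Unset Printing Implicit Defensive.

Import GRing.Theory.
Local Open Scope ring_scope.
Local Open Scope quotient_scope.

Section Span.
Variables (K : fieldType) (V : lmodType K) (S : V -> Prop).

Inductive in_span : V -> Prop :=
| in_span0 : in_span 0
| in_spanD (a : K) (x y : V) : S x -> in_span y -> in_span (a *: x + y).

Definition span : {pred V} := fun x => `[< in_span x >].

Lemma spanP x : reflect (in_span x) (x \in span).
Proof. exact: asboolP. Qed.

Lemma in_span_lin a x y : in_span x -> in_span y -> in_span (a *: x + y).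
Proof.
move=> hx; elim: hx y => [|b u v Su _ IH] y hy.
  by rewrite scaler0 add0r.
by rewrite scalerDr scalerA -addrA; apply: in_spanD => //; apply: IH.
Qed.

Lemma in_span_sub x : S x -> in_span x.
Proof. by move=> Sx; rewrite -[x]addr0 -[x]scale1r; apply: in_spanD in_span0. Qed.

Lemma span_submod : submod_closed span.
Proof.
split; first by apply/spanP; apply: in_span0.
by move=> a x y /spanP hx /spanP hy; apply/spanP/in_span_lin.
Qed.

HB.instance Definition _ := GRing.isSubmodClosed.Build K V span span_submod.

Definition quotmod : Type := Quotient.quot span.

HB.instance Definition _ := GRing.Zmodule.on quotmod.

Definition qpi (x : V) : quotmod := \pi x.
Definition qrepr (x : quotmod) : V := repr x.

Lemma qreprK x : qpi (qrepr x) = x. Proof. exact: reprK. Qed.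

Lemma qpi_eqP x y : reflect (qpi x = qpi y) (x - y \in span).
Proof. by rewrite (Quotient.idealrBE span); apply/(iffP eqP). Qed.

Lemma qpi_eq0 x : (qpi x = 0) <-> in_span x.
Proof.
have h0 : qpi 0 = 0 by rewrite /qpi raddf0.
rewrite -h0; split=> [/qpi_eqP|hx]; first by rewrite subr0 => /spanP.
by apply/qpi_eqP; rewrite subr0; apply/spanP.
Qed.

Lemma qpiD x y : qpi (x + y) = qpi x + qpi y.
Proof. exact: raddfD. Qed.

Definition qscale (a : K) (x : quotmod) : quotmod := qpi (a *: qrepr x).

Lemma qpiZ a x : qpi (a *: x) = qscale a (qpi x).
Proof.
apply/qpi_eqP; rewrite -scalerBr rpredZ //; apply/qpi_eqP.
by rewrite qreprK.
Qed.

Fact qscaleA a b v : qscale a (qscale b v) = qscale (a * b) v.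
Proof. by rewrite -[v]qreprK -!qpiZ scalerA. Qed.
Fact qscale1 : left_id 1 qscale.
Proof. by move=> v; rewrite -[v]qreprK -qpiZ scale1r. Qed.
Fact qscaleDr : right_distributive qscale +%R.
Proof.
move=> a u v; rewrite -[u]qreprK -[v]qreprK -!qpiZ -!qpiD -qpiZ.
by rewrite scalerDr.
Qed.
Fact qscaleDl v : {morph qscale^~ v : a b / a + b}.
Proof. by move=> a b; rewrite -[v]qreprK -!qpiZ -qpiD scalerDl. Qed.

HB.instance Definition _ := GRing.Zmodule_isLmodule.Build K quotmod
  qscaleA qscale1 qscaleDr qscaleDl.

Fact qpi_linear : linear qpi.
Proof. by move=> a x y; rewrite qpiD qpiZ. Qed.
HB.instance Definition _ := GRing.isLinear.Build K V quotmod _ qpi qpi_linear.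

End Span.

Arguments qpi {K V S}.

Section FreeLift.
Variables (K : fieldType) (T : choiceType) (U : lmodType K) (f : T -> U).

Definition free_lift (g : {malg K[T]}) : U :=
  \sum_(t <- msupp g) g@_t *: f t.

Lemma free_liftEw (d : {fset T}) (g : {malg K[T]}) :
  (msupp g `<=` d)%fset -> free_lift g = \sum_(t <- d) g@_t *: f t.
Proof.
move=> le; rewrite /free_lift (big_fset_incl _ le) => //= x _ /mcoeff_outdom ->.
by rewrite scale0r.
Qed.

Fact free_lift_linear : linear free_lift.
Proof.
move=> a g h; set d := (msupp g `|` msupp h `|` msupp (a *: g + h))%fset.
rewrite 3?(@free_liftEw d).
- rewrite scaler_sumr -big_split; apply: eq_bigr => t _ /=.
  by rewrite mcoeffD mcoeffZ scalerDl scalerA.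
- by apply: fsubset_trans (fsubsetUl _ _); apply: fsubsetUr.
- by apply: fsubset_trans (fsubsetUl _ _); apply: fsubsetUl.
- exact: fsubsetUr.
Qed.
HB.instance Definition _ :=
  GRing.isLinear.Build K {malg K[T]} U _ free_lift free_lift_linear.

Lemma free_liftU t : free_lift << t >> = f t.
Proof.
rewrite (@free_liftEw [fset t]%fset) ?msuppU_le //.
by rewrite big_seq_fset1 mcoeffUU scale1r.
Qed.
End FreeLift.

Section Presented.
Variables (K : fieldType) (T : choiceType) (S : {malg K[T]} -> Prop).

Definition presmod : Type := quotmod S.
HB.instance Definition _ := GRing.Lmodule.on presmod.

Definition pgen (t : T) : presmod := qpi << t >>.

(* The linear map sending each generator t to f t; it is the intended map
   only when f satisfies the relations S (pliftE, plift_linear). *)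
Definition plift (U : lmodType K) (f : T -> U) (x : presmod) : U :=
  free_lift f (qrepr x).

Definition respects (U : lmodType K) (f : T -> U) :=
  forall x, S x -> free_lift f x = 0.

Lemma plift_qpi (U : lmodType K) (f : T -> U) (g : {malg K[T]}) :
  respects f -> plift f (qpi g) = free_lift f g.
Proof.
move=> hf; have : qpi (qrepr (qpi g : quotmod S)) = qpi g :> quotmod S.
  exact: qreprK.
move/qpi_eqP/spanP => h; apply/eqP; rewrite /plift -subr_eq0 -linearB /=.
move: h; move: (_ - _) => z; elim=> [|a x y /hf hx _ /eqP hy].
  by rewrite linear0.
by rewrite linearP /= hx hy scaler0 addr0.
Qed.

Lemma pliftE (U : lmodType K) (f : T -> U) t :
  respects f -> plift f (pgen t) = f t.
Proof. by move=> hf; rewrite plift_qpi // free_liftU. Qed.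

Lemma plift_linear (U : lmodType K) (f : T -> U) :
  respects f -> linear (plift f).
Proof.
move=> hf a x y; rewrite -[x]qreprK -[y]qreprK.
have -> : a *: (qpi (qrepr x) : presmod) + (qpi (qrepr y) : presmod) =
          qpi (a *: qrepr x + qrepr y) by rewrite linearP.
by rewrite !plift_qpi // linearP.
Qed.

Lemma pgen_rel t a u v :
  S (<< t >> - a *: << u >> - << v >>) -> pgen t = a *: pgen u + pgen v.
Proof.
move=> hS; have -> : a *: pgen u + pgen v = qpi (a *: << u >> + << v >>).
  by rewrite linearP.
by apply/qpi_eqP/spanP/in_span_sub; rewrite opprD addrA.
Qed.

Lemma presmod_ind (P : presmod -> Prop) :
  P 0 -> (forall a t y, P y -> P (a *: pgen t + y)) -> forall x, P x.
Proof.
move=> P0 PD x; rewrite -[x]qreprK; move: (qrepr x) => g.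
have -> : (qpi g : presmod) = \sum_(t <- msupp g) g@_t *: pgen t.
  rewrite {1}[g]monalgE linear_sum; apply: eq_bigr => t _.
  rewrite -[_ *: _]linearZ; congr (qpi _).
  by apply/malgP => k; rewrite mcoeffZ !mcoeffU; case: eqP; rewrite ?mulr1 ?mulr0.
elim: (enum_fset _) => [|t s IH]; first by rewrite big_nil.
by rewrite big_cons; apply: PD.
Qed.

Lemma presmod_eq (U : lmodType K) (f g : presmod -> U) :
  linear f -> linear g -> (forall t, f (pgen t) = g (pgen t)) -> f =1 g.
Proof.
move=> hf hg h; have f0 : f 0 = 0.
  by have := hf (-1) 0 0; rewrite scaler0 addr0 scaleN1r addNr.
have g0 : g 0 = 0.
  by have := hg (-1) 0 0; rewrite scaler0 addr0 scaleN1r addNr.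
elim/presmod_ind=> [|a t y IH]; first by rewrite f0 g0.
by rewrite hf hg h IH.
Qed.
End Presented.

Arguments pgen {K T S}.
Arguments plift {K T S U}.

Section Tensor.
Variables (K : fieldType) (V W : lmodType K).

Definition bilinear_rel (x : {malg K[(V * W)%type]}) : Prop :=
  (exists a v v' w, x = << (a *: v + v', w) >> - a *: << (v, w) >> - << (v', w) >>)
  \/ (exists a v w w', x = << (v, a *: w + w') >> - a *: << (v, w) >> - << (v, w') >>).

Definition tens : Type := presmod bilinear_rel.
HB.instance Definition _ := GRing.Lmodule.on tens.

Definition tpure (v : V) (w : W) : tens := pgen (v, w).

Definition is_bilinear (U : lmodType K) (f : V -> W -> U) :=
  (forall w, linear (f^~ w)) /\ (forall v, linear (f v)).

Definition tlift (U : lmodType K) (f : V -> W -> U) : tens -> U :=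
  plift (fun p => f p.1 p.2).

Lemma bilinear_respects (U : lmodType K) (f : V -> W -> U) :
  is_bilinear f -> respects bilinear_rel (fun p => f p.1 p.2).
Proof.
case=> fl fr x [] [a [v [w [w']]]] ->.
  by rewrite !linearB linearZ /= !free_liftU /= fl -addrA -opprD subrr.
by rewrite !linearB linearZ /= !free_liftU /= fr -addrA -opprD subrr.
Qed.

Lemma tliftE (U : lmodType K) (f : V -> W -> U) v w :
  is_bilinear f -> tlift f (tpure v w) = f v w.
Proof. by move=> /bilinear_respects hf; rewrite /tlift pliftE. Qed.

Lemma tlift_linear (U : lmodType K) (f : V -> W -> U) :
  is_bilinear f -> linear (tlift f).
Proof. by move=> /bilinear_respects hf; apply: plift_linear. Qed.

Lemma tpure_bilinear : is_bilinear tpure.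
Proof.
split=> [w a v v'|v a w w'].
  by apply: pgen_rel; left; exists a, v, v', w.
by apply: pgen_rel; right; exists a, v, w, w'.
Qed.

Lemma tens_ind (P : tens -> Prop) :
  P 0 -> (forall v w y, P y -> P (tpure v w + y)) -> forall x, P x.
Proof.
move=> P0 PD; apply: presmod_ind => // a [v w] y Py.
have h0 : tpure 0 w = 0.
  by have := tpure_bilinear.1 w (-1) 0 0; rewrite scaler0 addr0 scaleN1r addNr.
have -> : a *: pgen (v, w) = tpure (a *: v) w.
  by have := tpure_bilinear.1 w a v 0; rewrite h0 !addr0 => ->.
exact: PD.
Qed.

Lemma tens_eq (U : lmodType K) (f g : tens -> U) :
  linear f -> linear g -> (forall v w, f (tpure v w) = g (tpure v w)) -> f =1 g.
Proof. by move=> hf hg h; apply: presmod_eq => // -[]. Qed.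

End Tensor.

Notation "v *t w" := (tpure v w) (at level 40, left associativity) : ring_scope.

Definition tens_map (K : fieldType) (V V' W W' : lmodType K)
    (f : V -> V') (g : W -> W') : tens V W -> tens V' W' :=
  tlift (fun v w => f v *t g w).

Definition tens_assoc (K : fieldType) (U V W : lmodType K) :
    tens (tens U V) W -> tens U (tens V W) :=
  tlift (fun x w => tlift (fun u v => u *t (v *t w)) x).

Definition tens_unitl (K : fieldType) (V : lmodType K) : tens K^o V -> V :=
  tlift (fun (a : K^o) v => (a : K) *: v).

Definition tens_unitr (K : fieldType) (V : lmodType K) : tens V K^o -> V :=
  tlift (fun v (a : K^o) => (a : K) *: v).

(* S (x) S', identified with its image in V (x) W (K is a field). *)
Definition subtens (K : fieldType) (V W : lmodType K)
    (S : {pred V}) (S' : {pred W}) : {pred tens V W} :=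
  span (fun x => exists v w, [/\ v \in S, w \in S' & x = v *t w]).

(* Used only to show that a tensor product of nonzero algebras is nonzero. *)
Lemma ex_functional (K : fieldType) (V : lmodType K) (e : V) :
  e != 0 -> exists2 f : V -> K^o, linear f & f e = 1.
Proof.
move=> e0.
pose good (P : V -> bool) := `[< submod_closed (P : {pred V}) /\ ~~ P e >].
pose T := {P : V -> bool | good P}.
pose R : rel T := fun P Q => `[< forall x, sval P x -> sval Q x >].
have goodP (P : T) : submod_closed (sval P : {pred V}) /\ ~~ sval P e.
  by case: P => P /= /asboolP.
have [||||P maxP] := @classical_sets.Zorn T R.
- by move=> P; apply/asboolP.
- move=> P Q S /asboolP PQ /asboolP QS; apply/asboolP => x Px.
  exact/QS/PQ.
- move=> P Q /asboolP PQ /asboolP QP; apply: val_inj => /=; apply/funext => x.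
  by apply/idP/idP; [apply: PQ | apply: QP].
- move=> A totA.
  pose U (x : V) := `[< x = 0 \/ exists2 s, A s & sval s x >].
  have gU : good U.
    apply/asboolP; split; last first.
      apply/asboolP => -[/eqP|[s _ se]]; first by rewrite (negPf e0).
      by have [_ /negP] := goodP s; apply.
    split; first by apply/asboolP; left.
    move=> a x y /asboolP hx /asboolP hy; apply/asboolP.
    case: hx hy => [->|[s As sx]] [->|[t At ty]].
    + by left; rewrite scaler0 addr0.
    + by right; exists t; rewrite ?scaler0 ?add0r.
    + right; exists s => //; have [[z0 h] _] := goodP s.
      exact: (h a x 0 sx z0).
    + right; case: (totA s t As At) => /asboolP st.
        exists t => //; have [[_ h] _] := goodP t; exact: (h a x y (st _ sx) ty).
      exists s => //; have [[_ h] _] := goodP s; exact: (h a x y sx (st _ ty)).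
  exists (exist _ U gU) => s As; apply/asboolP => x sx /=.
  by apply/asboolP; right; exists s.
have [[P0 Pl] Pe] := goodP P.
have ex x : exists c : K, sval P (x - c *: e).
  have [Px|nPx] := boolP (sval P x); first by exists 0; rewrite scale0r subr0.
  pose U (y : V) := `[< exists2 c : K, True & sval P (y - c *: x) >].
  have PU y : sval P y -> U y.
    by move=> Py; apply/asboolP; exists 0; rewrite // scale0r subr0.
  have clU : submod_closed (U : {pred V}).
    split; first exact/PU/P0.
    move=> a y z /asboolP [c _ hy] /asboolP [d _ hz]; apply/asboolP.
    exists (a * c + d) => //; have := Pl a _ _ hy hz.
    by rewrite scalerBr scalerA addrACA -opprD -scalerDl.
  have [|nUe] := boolP (U e); last first.
    have gU : good U by apply/asboolP.
    have : P = exist _ U gU.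
      by apply: esym; apply: maxP; apply/asboolP => y; apply: PU.
    move/(congr1 sval) => /= EP; case/negP: nPx; rewrite EP.
    by apply/asboolP; exists 1; rewrite // scale1r subrr.
  case/asboolP => c _ hc.
  have c0 : c != 0.
    by apply: contra Pe => /eqP c0; move: hc; rewrite c0 scale0r subr0.
  exists c^-1; have := Pl (- c^-1) _ _ hc P0.
  by rewrite addr0 scalerBr scalerA !scaleNr mulNr mulVf // scaleN1r opprK addrC.
have uniq x c d : sval P (x - c *: e) -> sval P (x - d *: e) -> c = d.
  move=> hc hd; apply/eqP; apply: contraNT Pe => cd.
  have := Pl (-1) _ _ hc hd.
  rewrite scaleN1r opprB addrA subrK -scalerBl => h.
  have := Pl (c - d)^-1 _ _ h P0.
  by rewrite addr0 scalerA mulVf ?subr_eq0 // scale1r.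
pose f x : K^o := projT1 (cid (ex x)).
have fP x : sval P (x - (f x : K) *: e) by rewrite /f; case: (cid _).
exists f.
  move=> a x y; apply: (uniq (a *: x + y)) (fP _) _.
  have := Pl a _ _ (fP x) (fP y).
  by rewrite scalerBr scalerA addrACA -opprD -scalerDl.
by apply: (uniq e) (fP _) _; rewrite scale1r subrr.
Qed.

Lemma lin_comb (K : fieldType) (U V : lmodType K) (c : K) (f g : U -> V) :
  linear f -> linear g -> linear (fun x => c *: f x + g x).
Proof.
move=> hf hg a x y; rewrite hf hg !scalerDr !scalerA (mulrC c a).
by rewrite addrACA.
Qed.

Lemma lin_scale (K : fieldType) (U V : lmodType K) (f : U -> V) :
  linear f -> forall a x, f (a *: x) = a *: f x.
Proof.
move=> hf a x; have f0 : f 0 = 0.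
  by have := hf (-1) 0 0; rewrite scaler0 addr0 scaleN1r addNr.
by have := hf a x 0; rewrite f0 !addr0.
Qed.

Lemma lin_id (K : fieldType) (U : lmodType K) : linear (@id U). Proof. by []. Qed.
Lemma lin_comp (K : fieldType) (U V W : lmodType K) (f : V -> W) (g : U -> V) :
  linear f -> linear g -> linear (fun x => f (g x)).
Proof. by move=> hf hg a x y; rewrite hg hf. Qed.

Section TensorAlgebra.
Variables (K : fieldType) (A B : algType K).
Implicit Types (x y z : tens A B).

Definition tmul (x y : tens A B) : tens A B :=
  tlift (fun a b => tlift (fun a' b' => (a * a') *t (b * b')) y) x.

Let tin (a : A) (b : B) (a' : A) (b' : B) := (a * a') *t (b * b').

Fact tin_bilinear a b : is_bilinear (tin a b).
Proof.
split=> [b' c u v|a' c u v]; rewrite /tin mulrDr -scalerAr.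
  exact: (tpure_bilinear A B).1.
exact: (tpure_bilinear A B).2.
Qed.

Fact tmul_bilinear_aux y : is_bilinear (fun a b => tlift (tin a b) y).
Proof.
split=> [b c u v|a c u v]; move: y; apply: tens_eq.
- exact/tlift_linear/tin_bilinear.
- by apply: lin_comb; apply/tlift_linear/tin_bilinear.
- move=> a' b'; rewrite !tliftE; try exact: tin_bilinear.
  by rewrite /tin mulrDl -scalerAl; apply: (tpure_bilinear A B).1.
- exact/tlift_linear/tin_bilinear.
- by apply: lin_comb; apply/tlift_linear/tin_bilinear.
- move=> a' b'; rewrite !tliftE; try exact: tin_bilinear.
  by rewrite /tin mulrDl -scalerAl; apply: (tpure_bilinear A B).2.
Qed.

Lemma tmul_linearl y : linear (tmul^~ y).
Proof. exact/tlift_linear/tmul_bilinear_aux. Qed.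

Lemma tmul_purel a b y : tmul (a *t b) y = tlift (tin a b) y.
Proof. by rewrite /tmul tliftE //; apply: tmul_bilinear_aux. Qed.

Lemma tmul_pure a b a' b' : tmul (a *t b) (a' *t b') = (a * a') *t (b * b').
Proof. by rewrite tmul_purel tliftE //; apply: tin_bilinear. Qed.

Lemma tmul_linearr x : linear (tmul x).
Proof.
move=> c y z; move: x; apply: tens_eq.
- exact: tmul_linearl.
- by apply: lin_comb; apply: tmul_linearl.
- by move=> a b; rewrite !tmul_purel tlift_linear //; apply: tin_bilinear.
Qed.

Fact tmulA : associative tmul.
Proof.
move=> x y z; move: x; apply: tens_eq.
- exact: tmul_linearl.
- exact: (lin_comp (tmul_linearl z) (tmul_linearl y)).
move=> a b; move: y; apply: tens_eq.
- exact: (lin_comp (tmul_linearr _) (tmul_linearl z)).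
- exact: (lin_comp (tmul_linearl z) (tmul_linearr _)).
move=> a' b'; move: z; apply: tens_eq.
- exact: (lin_comp (tmul_linearr _) (tmul_linearr _)).
- exact: tmul_linearr.
by move=> a'' b''; rewrite !tmul_pure !mulrA.
Qed.

Fact tmul1l : left_id (1 *t 1) tmul.
Proof.
apply: tens_eq; [exact: tmul_linearr | exact: lin_id |].
by move=> a b; rewrite tmul_pure !mul1r.
Qed.

Fact tmul1r : right_id (1 *t 1) tmul.
Proof.
apply: tens_eq; [exact: tmul_linearl | exact: lin_id |].
by move=> a b; rewrite tmul_pure !mulr1.
Qed.

Fact tmulDl : left_distributive tmul +%R.
Proof. by move=> x y z; have := tmul_linearl z 1 x y; rewrite !scale1r. Qed.

Fact tmulDr : right_distributive tmul +%R.
Proof. by move=> z x y; have := tmul_linearr z 1 x y; rewrite !scale1r. Qed.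

Fact tone_neq0 : (1 : A) *t (1 : B) != 0.
Proof.
have [f lf f1] := ex_functional (oner_neq0 A).
have [g lg g1] := ex_functional (oner_neq0 B).
pose h (a : A) (b : B) : K^o := (f a : K) * g b.
have bh : is_bilinear h.
  split=> [b c u v|a c u v]; rewrite /h.
    by rewrite lf mulrDl -[RHS]/(c * _ + _) mulrA.
  by rewrite lg mulrDr -[RHS]/(c * _ + _) mulrCA.
apply/eqP => /(congr1 (tlift h)); rewrite tliftE // /h f1 g1 mulr1.
have := tlift_linear bh (-1) 0 0; rewrite scaler0 addr0 scaleN1r addNr => ->.
exact/eqP/oner_neq0.
Qed.

HB.instance Definition _ := GRing.Zmodule_isNzRing.Build (tens A B)
  tmulA tmul1l tmul1r tmulDl tmulDr tone_neq0.

Fact tscaleAl (a : K) x y : a *: (x * y) = (a *: x) * y.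
Proof.
exact: esym (lin_scale (tmul_linearl y) a x).
Qed.
HB.instance Definition _ :=
  GRing.Lmodule_isLalgebra.Build K (tens A B) tscaleAl.

Fact tscaleAr (a : K) x y : a *: (x * y) = x * (a *: y).
Proof.
exact: esym (lin_scale (tmul_linearr x) a y).
Qed.
HB.instance Definition _ :=
  GRing.Lalgebra_isAlgebra.Build K (tens A B) tscaleAr.

End TensorAlgebra.

Section QuotAlgebra.
Variables (K : fieldType) (A : algType K) (S : A -> Prop).

(* The two-sided ideal generated by S is the span of the products a r b. *)
Definition ideal_gen (x : A) : Prop := exists a r b, S r /\ x = a * r * b.

Definition in_ideal : A -> Prop := in_span ideal_gen.

(* MathComp algebras are nonzero, hence the argument proper. *)
Definition quotalg (proper : ~ in_ideal 1) : Type := quotmod ideal_gen.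

Variable proper : ~ in_ideal 1.
Local Notation Q := (quotalg proper).

HB.instance Definition _ := GRing.Lmodule.on Q.

Definition api (a : A) : Q := qpi a.
Definition arepr (x : Q) : A := qrepr x.

Lemma areprK x : api (arepr x) = x. Proof. exact: qreprK. Qed.

Lemma api_eqP a b : api a = api b <-> in_ideal (a - b).
Proof. by split=> [/qpi_eqP/spanP|h] //; apply/qpi_eqP/spanP. Qed.

Lemma in_idealMl a x : in_ideal x -> in_ideal (a * x).
Proof.
elim=> [|c u v [a1 [r [b [Sr ->]]]] _ IH]; first by rewrite mulr0; apply: in_span0.
rewrite mulrDr -scalerAr; apply: in_spanD IH.
by exists (a * a1), r, b; rewrite !mulrA.
Qed.

Lemma in_idealMr a x : in_ideal x -> in_ideal (x * a).
Proof.
elim=> [|c u v [a1 [r [b [Sr ->]]]] _ IH]; first by rewrite mul0r; apply: in_span0.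
rewrite mulrDl -scalerAl; apply: in_spanD IH.
by exists a1, r, (b * a); rewrite !mulrA.
Qed.

Definition qmul (x y : Q) : Q := api (arepr x * arepr y).

Fact api_mul a b : api (a * b) = qmul (api a) (api b).
Proof.
apply/api_eqP; set a' := arepr _; set b' := arepr _.
have ha : in_ideal (a - a') by apply/api_eqP; rewrite areprK.
have hb : in_ideal (b - b') by apply/api_eqP; rewrite areprK.
have -> : a * b - a' * b' = 1 *: ((a - a') * b) + a' * (b - b').
  by rewrite scale1r mulrBl mulrBr addrA subrK.
by apply: in_span_lin; [apply: in_idealMr | apply: in_idealMl].
Qed.

Fact api_add a b : api (a + b) = api a + api b.
Proof. exact: qpiD. Qed.

Fact api_linear : linear api.
Proof. exact: qpi_linear. Qed.

Fact qmulA : associative qmul.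
Proof.
by move=> x y z; rewrite -[x]areprK -[y]areprK -[z]areprK -!api_mul mulrA.
Qed.
Fact qmul1l : left_id (api 1) qmul.
Proof. by move=> x; rewrite -[x]areprK -api_mul mul1r. Qed.
Fact qmul1r : right_id (api 1) qmul.
Proof. by move=> x; rewrite -[x]areprK -api_mul mulr1. Qed.
Fact qmulDl : left_distributive qmul +%R.
Proof.
move=> x y z; rewrite -[x]areprK -[y]areprK -[z]areprK -api_add -!api_mul.
by rewrite mulrDl api_add.
Qed.
Fact qmulDr : right_distributive qmul +%R.
Proof.
move=> x y z; rewrite -[x]areprK -[y]areprK -[z]areprK -api_add -!api_mul.
by rewrite mulrDr api_add.
Qed.
Fact qone_neq0 : api 1 != 0.
Proof. by apply/eqP => /qpi_eq0. Qed.

HB.instance Definition _ := GRing.Zmodule_isNzRing.Build Q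
  qmulA qmul1l qmul1r qmulDl qmulDr qone_neq0.

Fact qscaleAl (a : K) (x y : Q) : a *: (x * y) = (a *: x) * y.
Proof.
rewrite -[x]areprK -[y]areprK -[_ * _]api_mul.
have apiZ c u : c *: api u = api (c *: u) by rewrite /api linearZ.
by rewrite !apiZ -[_ * api _]api_mul scalerAl.
Qed.
HB.instance Definition _ := GRing.Lmodule_isLalgebra.Build K Q qscaleAl.

Fact qscaleAr (a : K) (x y : Q) : a *: (x * y) = x * (a *: y).
Proof.
rewrite -[x]areprK -[y]areprK -[_ * _]api_mul.
have apiZ c u : c *: api u = api (c *: u) by rewrite /api linearZ.
by rewrite !apiZ -[api _ * _]api_mul scalerAr.
Qed.
HB.instance Definition _ := GRing.Lalgebra_isAlgebra.Build K Q qscaleAr.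

HB.instance Definition _ := GRing.isLinear.Build K A Q _ api api_linear.
HB.instance Definition _ :=
  GRing.isMonoidMorphism.Build A Q api (erefl, api_mul).


Lemma in_ideal_kill (B : algType K) (f : {lrmorphism A -> B}) x :
  (forall r, S r -> f r = 0) -> in_ideal x -> f x = 0.
Proof.
move=> hS; elim=> [|c u v [a [r [b [Sr ->]]]] _ IH]; first by rewrite linear0.
by rewrite linearP /= IH !rmorphM /= (hS _ Sr) mulr0 mul0r scaler0 addr0.
Qed.

End QuotAlgebra.

Lemma aug_proper (K : fieldType) (A : algType K) (S : A -> Prop) (f : A -> K) :
    (forall c x y, f (c *: x + y) = c * f x + f y) ->
    (forall x y, f (x * y) = f x * f y) -> f 1 = 1 ->
  (forall r, S r -> f r = 0) -> forall x, in_ideal S x -> f x = 0.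
Proof.
move=> fl fm f1 fS x; have f0 : f 0 = 0.
  by have := fl (-1) 0 0; rewrite scaler0 addr0 mulN1r addNr.
elim=> [//|c u v [a [r [b [Sr ->]]]] _ IH].
by rewrite fl IH !fm (fS _ Sr) mulr0 mul0r mulr0 addr0.
Qed.

Section TensorPower.
Variables (K : fieldType) (N : nat) (E : lmodType K).

Definition upd (t : {ffun 'I_N -> E}) (i : 'I_N) (u : E) : {ffun 'I_N -> E} :=
  [ffun j => if j == i then u else t j].

Definition multilinear_rel (x : {malg K[{ffun 'I_N -> E}]}) : Prop :=
  exists t i a u v,
    x = << upd t i (a *: u + v) >> - a *: << upd t i u >> - << upd t i v >>.

Definition tpow : Type := presmod multilinear_rel.
HB.instance Definition _ := GRing.Lmodule.on tpow.

Definition tpow_pure (t : {ffun 'I_N -> E}) : tpow := pgen t.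

Definition is_multilinear (U : lmodType K) (f : {ffun 'I_N -> E} -> U) :=
  forall t i, linear (fun u => f (upd t i u)).

Definition tpow_lift (U : lmodType K) (f : {ffun 'I_N -> E} -> U) : tpow -> U :=
  plift f.

Lemma multilinear_respects (U : lmodType K) (f : {ffun 'I_N -> E} -> U) :
  is_multilinear f -> respects multilinear_rel f.
Proof.
move=> hf x [t [i [a [u [v ->]]]]].
by rewrite !linearB linearZ /= !free_liftU hf -addrA -opprD subrr.
Qed.

Lemma tpow_liftE (U : lmodType K) (f : {ffun 'I_N -> E} -> U) t :
  is_multilinear f -> tpow_lift f (tpow_pure t) = f t.
Proof. by move=> /multilinear_respects hf; apply: pliftE. Qed.

Lemma tpow_lift_linear (U : lmodType K) (f : {ffun 'I_N -> E} -> U) :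
  is_multilinear f -> linear (tpow_lift f).
Proof. by move=> /multilinear_respects hf; apply: plift_linear. Qed.

Lemma tpow_pure_multilinear : is_multilinear tpow_pure.
Proof. by move=> t i a u v; apply: pgen_rel; exists t, i, a, u, v. Qed.

Lemma tpow_eq (U : lmodType K) (f g : tpow -> U) :
  linear f -> linear g -> (forall t, f (tpow_pure t) = g (tpow_pure t)) ->
  f =1 g.
Proof. by move=> hf hg h x; apply: (presmod_eq hf hg h). Qed.

End TensorPower.

Arguments tpow {K} N E.

Section TensorPower2.
Variables (K : fieldType) (N : nat) (E E' U : lmodType K).
Variable f : {ffun 'I_N -> E} -> {ffun 'I_N -> E'} -> U.
Hypothesis fl : forall t', is_multilinear (f^~ t').
Hypothesis fr : forall t, is_multilinear (f t).

Lemma tpow_lift2_multilinear y :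
  is_multilinear (fun t => tpow_lift (f t) y).
Proof.
move=> t i a u v; move: y; apply: tpow_eq.
- exact: tpow_lift_linear.
- by apply: lin_comb; apply: tpow_lift_linear.
- by move=> t'; rewrite !tpow_liftE //; apply: fl.
Qed.

Lemma tpow_lift2_bilinear :
  is_bilinear (fun x y => tpow_lift (fun t => tpow_lift (f t) y) x).
Proof.
split=> [y|x].
  exact/tpow_lift_linear/tpow_lift2_multilinear.
move=> a y z; move: x; apply: tpow_eq.
- exact/tpow_lift_linear/tpow_lift2_multilinear.
- by apply: lin_comb; apply/tpow_lift_linear/tpow_lift2_multilinear.
- move=> t; rewrite !(tpow_liftE _ (tpow_lift2_multilinear _)).
  exact: tpow_lift_linear.
Qed.

Lemma tpow_lift2E t t' :
  tpow_lift (fun t => tpow_lift (f t) (tpow_pure t')) (tpow_pure t) = f t t'.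
Proof. by rewrite (tpow_liftE _ (tpow_lift2_multilinear _)) tpow_liftE. Qed.

End TensorPower2.

Section FreeAlgebra.
Variables (K : fieldType) (I : choiceType).

(* A new name, since {malg _[_]} carries an algebra structure only over
   commutative monoids. *)
Definition freealg : Type := {malg K[{fmonom I}]}.
HB.instance Definition _ := GRing.Lalgebra.on freealg.

Definition fgen (i : I) : freealg := << fmu i >>.

Fact fmalg_scaleAr (c : K) (x y : {malg K[{fmonom I}]}) :
  c *: (x * y) = x * (c *: y).
Proof.
apply/malgP => k; rewrite mcoeffZ.
have sub : (msupp (c *: y) `<=` msupp y)%fset by apply: msuppZ_le.
have e1 := mcoeffMlw k (fsubset_refl (msupp x)) (fsubset_refl (msupp y)).
have e2 := mcoeffMlw k (fsubset_refl (msupp x)) sub.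
apply: (etrans (congr1 ( *%R c) e1)); apply: (etrans _ (esym e2)).
rewrite mulr_sumr; apply: eq_bigr => k1 _.
rewrite mulr_sumr; apply: eq_bigr => k2 _.
by rewrite mcoeffZ mulrnAr mulrCA.
Qed.

Fact freealg_scaleAr (c : K) (x y : freealg) : c *: (x * y) = x * (c *: y).
Proof. exact: fmalg_scaleAr. Qed.

HB.instance Definition _ :=
  GRing.Lalgebra_isAlgebra.Build K freealg freealg_scaleAr.

Definition faug (x : freealg) : K := mcoeff mone (x : {malg K[{fmonom I}]}).

Fact faug_linear c x y : faug (c *: x + y) = c * faug x + faug y.
Proof. by rewrite /faug mcoeffD mcoeffZ. Qed.
Fact faugM x y : faug (x * y) = faug x * faug y.
Proof. exact: (rmorphM (mcoeff (mone : {fmonom I}))). Qed.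
Fact faug1 : faug 1 = 1.
Proof. by rewrite /faug mcoeff1 eqxx. Qed.
Fact faug_gen i : faug (fgen i) = 0.
Proof. by rewrite /faug mcoeffU fm1_eq1. Qed.

End FreeAlgebra.

Arguments fgen K {I}.

Section TensorAlg.
Variables (K : fieldType) (E : lmodType K).

Definition linear_rel (x : freealg K E) : Prop :=
  exists a u v, x = fgen K (a *: u + v) - a *: fgen K u - fgen K v.

Fact linear_rel_aug x : in_ideal linear_rel x -> faug x = 0.
Proof.
apply: aug_proper; [exact: faug_linear|exact: faugM|exact: faug1|].
move=> r [a [u [v ->]]]; rewrite -addrA -opprD -scaleN1r addrC faug_linear.
by rewrite faug_linear !faug_gen !mulr0 !addr0 mulr0.
Qed.

Fact linear_rel_proper : ~ in_ideal linear_rel 1.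
Proof. by move/linear_rel_aug/eqP; rewrite faug1 oner_eq0. Qed.

(* T(E), as the free algebra on the underlying set of E modulo the relations
   making tgen : E -> T(E) linear. *)
Definition talg : Type := quotalg linear_rel_proper.
HB.instance Definition _ := GRing.Algebra.on talg.

Definition tgen (e : E) : talg := api linear_rel_proper (fgen K e).

Lemma tgen_linear : linear tgen.
Proof.
move=> a u v; rewrite /tgen.
have -> : a *: api linear_rel_proper (fgen K u) + api _ (fgen K v) =
          api linear_rel_proper (a *: fgen K u + fgen K v).
  by rewrite linearP.
apply/api_eqP/in_span_sub; exists 1.
exists (fgen K (a *: u + v) - a *: fgen K u - fgen K v), 1.
by rewrite mul1r mulr1 opprD addrA; split=> //; exists a, u, v.
Qed.

Definition taug (x : talg) : K :=
  faug (arepr (x : quotalg linear_rel_proper)).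

Lemma taug_api a : taug (api linear_rel_proper a) = faug a.
Proof.
have h : in_ideal linear_rel (arepr (api linear_rel_proper a) - a).
  by apply/(api_eqP linear_rel_proper); rewrite areprK.
rewrite /taug -[X in faug X](subrK a) -[X in X + a]scale1r faug_linear.
by rewrite linear_rel_aug // mulr0 add0r.
Qed.

Lemma taug_linear c x y : taug (c *: x + y) = c * taug x + taug y.
Proof.
rewrite -(areprK (x : quotalg linear_rel_proper)).
rewrite -(areprK (y : quotalg linear_rel_proper)).
move: (arepr _) (arepr _) => a b.
by rewrite -[_ + _](api_linear linear_rel_proper) !taug_api faug_linear.
Qed.

Lemma taugM x y : taug (x * y) = taug x * taug y.
Proof.
rewrite -(areprK (x : quotalg linear_rel_proper)).
rewrite -(areprK (y : quotalg linear_rel_proper)).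
move: (arepr _) (arepr _) => a b.
by rewrite -[_ * _ : talg](api_mul linear_rel_proper) !taug_api faugM.
Qed.

Lemma taug1 : taug 1 = 1.
Proof.
have -> : (1 : talg) = api linear_rel_proper 1 by [].
by rewrite taug_api faug1.
Qed.

Lemma taug_gen e : taug (tgen e) = 0.
Proof. by rewrite taug_api faug_gen. Qed.

Definition tpow_talg (N : nat) : tpow N E -> talg :=
  tpow_lift (fun t => \prod_(i < N) tgen (t i)).

Lemma prod_multilinear (N : nat) :
  is_multilinear (fun t : {ffun 'I_N -> E} => \prod_(i < N) tgen (t i)).
Proof.
move=> t i a u v.
pose F w (r : seq 'I_N) : talg := \prod_(j <- r) tgen (upd t i w j).
have F0 w w' r : i \notin r -> F w r = F w' r.
  move=> ir; apply: eq_big_seq => j jr; rewrite !ffunE ifN ?ifN //;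
    by apply: contraNneq ir => <-.
suff h r : uniq r -> i \in r -> F (a *: u + v) r = a *: F u r + F v r.
  by apply: h; rewrite ?index_enum_uniq ?mem_index_enum.
elim: r => // j r IH /= /andP[jr ur]; rewrite inE /F !big_cons -!/(F _ _).
rewrite !ffunE; have [ji _|ji ir] := eqVneq j i; last first.
  by rewrite IH // mulrDr scalerAr.
move: jr; rewrite ji => jr.
rewrite (F0 (a *: u + v) 0 r jr) (F0 u 0 r jr) (F0 v 0 r jr).
by rewrite tgen_linear mulrDl scalerAl.
Qed.

Lemma tpow_talg_pure N (t : {ffun 'I_N -> E}) :
  tpow_talg (tpow_pure t) = \prod_(i < N) tgen (t i).
Proof. by rewrite /tpow_talg tpow_liftE //; apply: prod_multilinear. Qed.

Lemma taug_tpow N (x : tpow N E) : (0 < N)%N -> taug (tpow_talg x) = 0.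
Proof.
case: N x => // N x _.
have t0 : taug 0 = 0.
  by have := taug_linear (-1) 0 0; rewrite scaler0 addr0 mulN1r addNr.
rewrite /tpow_talg /tpow_lift /plift /free_lift.
elim: (enum_fset _) => [|t s IH]; first by rewrite big_nil.
by rewrite big_cons taug_linear IH big_ord_recl taugM taug_gen mul0r mulr0 addr0.
Qed.

End TensorAlg.

Section NHomogeneous.
Variables (K : fieldType) (N : nat) (hN : (2 <= N)%N).

Section Def.
Variables (E : lmodType K) (R : {pred tpow N E}).

Definition nh_rel (x : talg E) : Prop := exists2 r, r \in R & x = tpow_talg r.

Fact nh_proper : ~ in_ideal nh_rel 1.
Proof.
move=> h; have /eqP : taug (1 : talg E) = 0.
  move: h; apply: aug_proper; [exact: taug_linear|exact: taugM|exact: taug1|].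
  by move=> _ [r _ ->]; apply/taug_tpow/ltnW.
by rewrite taug1 oner_eq0.
Qed.

(* A(E, R) = T(E) / (R).  The argument hN : 2 <= N also makes it nonzero.
   Finite dimension of E plays no role in the construction. *)
Definition nhalg : Type := quotalg nh_proper.
HB.instance Definition _ := GRing.Algebra.on nhalg.

Definition nhgen (e : E) : nhalg := api nh_proper (tgen e).
End Def.

Definition tpow_pairing (E : vectType K)
    (x : tpow N 'Hom(E, K^o)) (y : tpow N E) : K^o :=
  tpow_lift (fun w : {ffun 'I_N -> 'Hom(E, K^o)} =>
    tpow_lift (fun t : {ffun 'I_N -> E} =>
      (\prod_(i < N) (w i (t i) : K)) : K^o) y) x.

Fact prod_affine (c : K) (i : 'I_N) (g g1 g2 : 'I_N -> K) :
    g i = c * g1 i + g2 i ->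
    (forall j, j != i -> g j = g1 j) -> (forall j, j != i -> g j = g2 j) ->
  \prod_j g j = c * \prod_j g1 j + \prod_j g2 j.
Proof.
move=> gi h1 h2; rewrite (bigD1 i) //= gi mulrDl -mulrA; congr (_ * _ + _).
  by rewrite [RHS](bigD1 i) //=; congr (_ * _); apply: eq_bigr.
by rewrite [RHS](bigD1 i) //=; congr (_ * _); apply: eq_bigr.
Qed.

Lemma tpow_pairing_pure (E : vectType K)
    (w : {ffun 'I_N -> 'Hom(E, K^o)}) (t : {ffun 'I_N -> E}) :
  tpow_pairing (tpow_pure w) (tpow_pure t) = \prod_(i < N) (w i (t i) : K).
Proof.
apply: tpow_lift2E => [t' w' i a u v|w' t' i a u v];
  apply: (@prod_affine a i) => [|j ji|j ji]; rewrite !ffunE ?eqxx ?(negPf ji) //.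
- by rewrite add_lfunE scale_lfunE.
- by rewrite linearP.
Qed.

(* R^perp, with E^*^{(x) N} identified with the dual of E^{(x) N} through the
   pairing above. *)
Definition perp (E : vectType K) (R : {pred tpow N E}) :
    {pred tpow N 'Hom(E, K^o)} :=
  fun x => `[< forall y, y \in R -> tpow_pairing x y = 0 >].

Section Products.
Variables (E E' : lmodType K).

Definition piN : tens (tpow N E) (tpow N E') -> tpow N (tens E E') :=
  tlift (fun x y =>
    tpow_lift (fun t : {ffun 'I_N -> E} =>
      tpow_lift (fun t' : {ffun 'I_N -> E'} =>
        tpow_pure [ffun i => t i *t t' i]) y) x).

Lemma piN_pure (t : {ffun 'I_N -> E}) (t' : {ffun 'I_N -> E'}) :
  piN (tpow_pure t *t tpow_pure t') = tpow_pure [ffun i => t i *t t' i].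
Proof.
pose f (t : {ffun 'I_N -> E}) (t' : {ffun 'I_N -> E'}) :=
  tpow_pure [ffun i => t i *t t' i].
have ml t0' : is_multilinear (f^~ t0').
  move=> t0 i a u v.
  have E0 w : [ffun j => upd t0 i w j *t t0' j] =
              upd [ffun j => t0 j *t t0' j] i (w *t t0' i).
    by apply/ffunP => j; rewrite !ffunE; case: eqVneq => // ->.
  rewrite /f !E0 ((tpure_bilinear E E').1 (t0' i) a u v).
  exact: tpow_pure_multilinear.
have mr t0 : is_multilinear (f t0).
  move=> t0' i a u v.
  have E0 w : [ffun j => t0 j *t upd t0' i w j] =
              upd [ffun j => t0 j *t t0' j] i (t0 i *t w).
    by apply/ffunP => j; rewrite !ffunE; case: eqVneq => // ->.
  rewrite /f !E0 ((tpure_bilinear E E').2 (t0 i) a u v).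
  exact: tpow_pure_multilinear.
by rewrite /piN (tliftE _ _ (tpow_lift2_bilinear ml mr)) tpow_lift2E.
Qed.

Definition bullet_rel (R : {pred tpow N E}) (R' : {pred tpow N E'}) :
    {pred tpow N (tens E E')} :=
  fun z => `[< exists2 x, x \in subtens R R' & z = piN x >].
End Products.

Section Hom.
Variables (E E' : vectType K) (R : {pred tpow N E}) (R' : {pred tpow N E'}).

(* A^! bullet B for A = A(E, R) and B = A(E', R'). *)
Definition homalg : Type := nhalg (bullet_rel (perp R) R').
HB.instance Definition _ := GRing.Algebra.on homalg.

Definition homgen (w : 'Hom(E, K^o)) (e' : E') : homalg :=
  nhgen (bullet_rel (perp R) R') (w *t e').
End Hom.

Definition dual_basis (E : vectType K) n (X : n.-tuple E) (i : 'I_n) :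
    'Hom(E, K^o) :=
  linfun (coord X i : E -> K^o).

Definition is_hom_coaction (E E' : vectType K)
    (R : {pred tpow N E}) (R' : {pred tpow N E'})
    (delta : nhalg R' -> tens (homalg R R') (nhalg R)) : Prop :=
  forall n (X : n.-tuple E), basis_of fullv X -> forall e' : E',
    delta (nhgen R' e') =
      \sum_(i < n) homgen R R' (dual_basis X i) e' *t nhgen R X`_i.

Definition is_hom_coproduct (E E' E'' : vectType K)
    (R : {pred tpow N E}) (R' : {pred tpow N E'}) (R'' : {pred tpow N E''})
    (Delta : homalg R R'' -> tens (homalg R' R'') (homalg R R')) : Prop :=
  forall n (X : n.-tuple E'), basis_of fullv X ->
  forall (w : 'Hom(E, K^o)) (e'' : E''),
    Delta (homgen R R'' w e'') =
      \sum_(j < n) homgen R' R'' (dual_basis X j) e'' *t homgen R R' w X`_j.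

End NHomogeneous.

Section Bialgebra.
Variables (K : fieldType) (H : algType K).
Variables (Delta : {lrmorphism H -> tens H H}) (eps : {lrmorphism H -> K^o}).

(* Delta and eps are algebra morphisms by their types. *)
Definition is_bialgebra : Prop :=
  [/\ forall x, tens_assoc (tens_map Delta id (Delta x))
                = tens_map id Delta (Delta x),
      forall x, tens_unitl (tens_map eps id (Delta x)) = x
    & forall x, tens_unitr (tens_map id eps (Delta x)) = x].

Definition is_left_comodule (M : lmodType K) (delta : {linear M -> tens H M}) :
    Prop :=
  (forall x, tens_assoc (tens_map Delta id (delta x))
             = tens_map id delta (delta x))
  /\ (forall x, tens_unitl (tens_map eps id (delta x)) = x).

End Bialgebra.

(* Main.v *)
(* Algebra morphisms out of A(E, R) are the linear maps on E whose
   multiplicative extension to E^{(x) N} kills R, and they are determined by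
   their values on E.  Hence coassociativity, counit and comodule laws reduce to
   generators, where they are identities about the canonical element
   sum_i e^i (x) e_i; the content lies in the existence of Delta and delta.
   There the multiplicative extension takes x (x) y, for x in perp R and y in R,
   to sum_J phi(e^J) (x) psi(e_J), over multi-indices J, where phi kills perp R
   and psi kills R, and every such sum vanishes. *)
Require Import Defs.
From mathcomp Require Import all_boot all_order all_algebra.
From HB Require Import structures.
From mathcomp Require Import boolp finmap monalg.

Set Implicit Arguments.
Unset Strict Implicit.
Unset Printing Implicit Defensive.

Import GRing.Theory.
Local Open Scope ring_scope.

(** * Algebra morphisms out of free, tensor and [N]-homogeneous algebras *)

Section AlgMorph.
Variable K : fieldType.

(** A property of bare functions, so that composites and maps built with [tlift] can be treated
    without bundling them first; [lrmorphism_of] bundles where a structure is required. *)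
Definition alg_morph (A B : algType K) (f : A -> B) :=
  linear f /\ monoid_morphism f.

Lemma alg_morph_comp (A B C : algType K) (f : B -> C) (g : A -> B) :
  alg_morph f -> alg_morph g -> alg_morph (f \o g).
Proof.
move=> [fl [f1 fM]] [gl [g1 gM]]; split; first exact: lin_comp.
by split=> [|x y] /=; rewrite ?g1 // gM fM.
Qed.

Lemma alg_morph_lrmorphism (A B : algType K) (f : {lrmorphism A -> B}) :
  alg_morph f.
Proof. by split; [exact: linearP | split; [exact: rmorph1 | exact: rmorphM]]. Qed.

Lemma lrmorphism_of (A B : algType K) (f : A -> B) :
  alg_morph f -> exists g : {lrmorphism A -> B}, g =1 f.
Proof.
move=> [fl fm].
pose ml := GRing.isLinear.Build K A B _ f fl.
pose mm := GRing.isMonoidMorphism.Build A B f fm.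
pose g : {lrmorphism A -> B} := HB.pack f ml mm.
by exists g.
Qed.

Lemma lin_sum (U V : lmodType K) (f : U -> V) I (r : seq I) (P : pred I) F :
  linear f -> f (\sum_(i <- r | P i) F i) = \sum_(i <- r | P i) f (F i).
Proof.
move=> lf; pose ml := GRing.isLinear.Build K U V _ f lf.
pose g : {linear U -> V} := HB.pack f ml.
exact: (linear_sum g).
Qed.

Lemma lin0 (U V : lmodType K) (f : U -> V) : linear f -> f 0 = 0.
Proof. by move=> lf; rewrite -{1}(scale0r 0) lin_scale // scale0r. Qed.

Lemma alg_morph_prod (A B : algType K) (f : A -> B) I (r : seq I) F :
  alg_morph f -> f (\prod_(i <- r) F i) = \prod_(i <- r) f (F i).
Proof.
move=> /lrmorphism_of [g gE]; rewrite -gE rmorph_prod; apply: eq_bigr => i _; apply: gE.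
Qed.

Section FreeAlgebraLift.
Variables (I : choiceType) (B : algType K) (F : I -> B).

Definition monom_val (m : {fmonom I}) : B := \prod_(i <- m) F i.

Fact monom_val_mmorphism : mmorphism monom_val.
Proof.
by split=> [m1 m2|]; rewrite /monom_val ?fmM ?big_cat // fm1 big_nil.
Qed.
HB.instance Definition _ := isMultiplicative.Build {fmonom I} B monom_val
  monom_val_mmorphism.

Definition freealg_lift (x : freealg K I) : B := free_lift monom_val x.

Lemma freealg_lift_morph : alg_morph freealg_lift.
Proof.
split; first exact: free_lift_linear.
have E x : freealg_lift x = mmap (in_alg B) monom_val x.
  by apply: eq_bigr => m _; rewrite mulr_algl.
(* [B] may be noncommutative: multiplicativity only asks that the images of the coefficients commute
   with the values of monomials, and scalars are central in [B]. *)
have [mM m1] : multiplicative (mmap (in_alg B) monom_val).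
  by apply: commr_mmap_is_multiplicative => c m m'; exact: comm_alg.
by split=> [|x y]; rewrite !E.
Qed.

Lemma freealg_lift_gen i : freealg_lift (fgen K i) = F i.
Proof. by rewrite /freealg_lift free_liftU /monom_val fmU big_seq1. Qed.

(** Linearity reduces the equality to monomials; a monomial is a word, handled by induction on its
    letters. *)
Lemma freealg_morph_eq (f g : freealg K I -> B) :
  alg_morph f -> alg_morph g -> (forall i, f (fgen K i) = g (fgen K i)) ->
  f =1 g.
Proof.
move=> [fl [f1 fM]] [gl [g1 gM]] fg x.
rewrite [x]monalgE (lin_sum _ _ _ fl) (lin_sum _ _ _ gl).
apply: eq_bigr => m _.
have -> : << x@_m *g m >> = x@_m *: (<< m >> : freealg K I).
  by apply/malgP => k; rewrite mcoeffZ !mcoeffU; case: eqP; rewrite ?mulr1 ?mulr0.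
rewrite (lin_scale fl) (lin_scale gl); congr (_ *: _).
case: m => s; elim: s => [|i s IH].
  have -> : FMonom (@nil I) = mone :> {fmonom I} by apply/val_inj; rewrite /= fm1.
  by rewrite f1 g1.
have -> : << FMonom (i :: s) >> = fgen K i * << FMonom s >> :> freealg K I.
  have -> : FMonom (i :: s) = mmul (fmu i) (FMonom s) :> {fmonom I}.
    by apply/val_inj; rewrite /= fmM fmU.
  rewrite [RHS](malgMEw msuppU_le msuppU_le) !big_seq_fset1 !mcoeffUU.
  by rewrite mulr1.
by rewrite fM gM fg IH.
Qed.

End FreeAlgebraLift.

(** The induced map evaluates [f] on the chosen representative. Two representatives differ by an
    element of the ideal, which [f] kills. *)
Lemma quotalg_lift (A B : algType K) (S : A -> Prop) (proper : ~ in_ideal S 1)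
    (f : A -> B) : alg_morph f -> (forall r, S r -> f r = 0) ->
  exists2 g : quotalg proper -> B,
    alg_morph g & forall a, g (api proper a) = f a.
Proof.
move=> /lrmorphism_of [h hE] fS.
have gE a : h (arepr (api proper a)) = h a.
  apply/eqP; rewrite -subr_eq0 -linearB /=; apply/eqP.
  apply: (@in_ideal_kill _ _ S); first by move=> r Sr; rewrite hE fS.
  by apply/(api_eqP proper); rewrite areprK.
exists (fun x => h (arepr x)) => [|a]; last by rewrite gE.
split=> [c x y|]; last split=> [|x y].
- rewrite -[x]areprK -[y]areprK -(api_linear proper) !gE; exact: linearP.
- exact: etrans (gE 1) (rmorph1 h).
- by rewrite -[x]areprK -[y]areprK -[_ * _](api_mul proper) !gE rmorphM.
Qed.

Lemma quotalg_ind (A : algType K) (S : A -> Prop) (proper : ~ in_ideal S 1)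
    (P : quotalg proper -> Prop) : (forall a, P (api proper a)) -> forall x, P x.
Proof. by move=> h x; rewrite -[x]areprK. Qed.

Lemma alg_morph_api (A : algType K) (S : A -> Prop) (proper : ~ in_ideal S 1) :
  alg_morph (api proper).
Proof. exact: alg_morph_lrmorphism. Qed.

(** The universal property of [T(E)]: linearity of [f] makes its extension to the free algebra kill
    [linear_rel]. *)
Lemma talg_lift (E : lmodType K) (B : algType K) (f : E -> B) : linear f ->
  exists2 g : talg E -> B, alg_morph g & forall e, g (tgen e) = f e.
Proof.
move=> fl; have [||g gm gE] := @quotalg_lift _ B _ (@linear_rel_proper K E)
  (freealg_lift f); first exact: freealg_lift_morph.
  move=> _ [a [u [v ->]]]; have [l _] := freealg_lift_morph f.
  have /lrmorphism_of [h hE] := freealg_lift_morph f.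
  rewrite -hE !linearB linearZ /= !hE !freealg_lift_gen fl.
  by rewrite addrAC addrK subrr.
by exists g => // e; rewrite gE freealg_lift_gen.
Qed.

(** For linear [f], the degree [N] component of the algebra morphism from [T(E)] to [B] that extends
    [f]. *)
Definition mulmap (N : nat) (E : lmodType K) (B : algType K) (f : E -> B) :
    tpow N E -> B := tpow_lift (fun t => \prod_(i < N) f (t i)).

(** Products of values of [f] are images of products of [tgen] under the extension of [f] to [T(E)],
    so multilinearity is inherited from [prod_multilinear]. *)
Lemma mulmap_multilinear (N : nat) (E : lmodType K) (B : algType K)
    (f : E -> B) : linear f ->
  is_multilinear (fun t : {ffun 'I_N -> E} => \prod_(i < N) f (t i)).
Proof.
move=> /talg_lift [g gm gE] t i a u v.
have h t' : \prod_(i < N) f (t' i) = g (\prod_(i < N) tgen (t' i)).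
  by rewrite (alg_morph_prod _ _ gm); apply: eq_bigr => j _; rewrite gE.
by rewrite !h (prod_multilinear t i a u v) gm.1.
Qed.

Section Mulmap.
Variables (N : nat) (E : lmodType K) (B : algType K) (f : E -> B).
Hypothesis fl : linear f.

Lemma mulmap_linear : linear (mulmap f : tpow N E -> B).
Proof. exact/tpow_lift_linear/mulmap_multilinear. Qed.

Lemma mulmap_pure (t : {ffun 'I_N -> E}) :
  mulmap f (tpow_pure t) = \prod_(i < N) f (t i).
Proof. by rewrite /mulmap tpow_liftE //; apply: mulmap_multilinear. Qed.
End Mulmap.

Lemma mulmap_comp (N : nat) (E : lmodType K) (A B : algType K) (g : A -> B)
    (f : E -> A) : alg_morph g -> linear f ->
  forall x : tpow N E, g (mulmap f x) = mulmap (g \o f) x.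
Proof.
move=> gm fl; have gfl : linear (g \o f) by apply: lin_comp fl; apply: gm.1.
apply: tpow_eq => [||t]; [apply: lin_comp gm.1 _ | |];
  try exact: mulmap_linear.
by rewrite !mulmap_pure // (alg_morph_prod _ _ gm).
Qed.

Section NHomogeneousLift.
Variables (N : nat) (hN : (2 <= N)%N) (E : lmodType K) (R : {pred tpow N E}).
Variable B : algType K.

Lemma nhgen_linear : linear (nhgen hN R).
Proof. exact: (lin_comp (alg_morph_api _).1 (@tgen_linear K E)). Qed.

Lemma mulmap_nhgen r : r \in R -> mulmap (nhgen hN R) r = 0.
Proof.
move=> Rr; rewrite -(mulmap_comp (alg_morph_api _) (@tgen_linear K E)).
apply/(qpi_eq0 (ideal_gen (nh_rel R)))/in_span_sub.
by exists 1, (tpow_talg r), 1; rewrite mul1r mulr1; split=> //; exists r.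
Qed.

Lemma nhalg_lift (f : E -> B) : linear f ->
    (forall r, r \in R -> mulmap f r = 0) ->
  exists g : {lrmorphism nhalg hN R -> B}, forall e, g (nhgen hN R e) = f e.
Proof.
move=> fl fR; have [g gm gE] := talg_lift fl.
have [|h hm hE] := quotalg_lift (nh_proper hN (R := R)) gm.
  (* [tpow_talg] is [mulmap] of [tgen] by definition, so [g] sends the relation given by [r] to
     [mulmap f r]. *)
  move=> _ [r Rr ->]; rewrite (mulmap_comp gm (@tgen_linear K E)).
  by rewrite (_ : g \o _ = f) ?fR //; apply/funext.
by have [k kE] := lrmorphism_of hm; exists k => e; rewrite kE hE gE.
Qed.

Lemma nhalg_morph_eq (f g : nhalg hN R -> B) : alg_morph f -> alg_morph g ->
  (forall e, f (nhgen hN R e) = g (nhgen hN R e)) -> f =1 g.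
Proof.
(* Two quotients are undone: [A(E, R)] comes from [T(E)], and [T(E)] from the free algebra, where
   morphisms are compared on letters. *)
move=> fm gm fg; apply: quotalg_ind; apply: quotalg_ind.
have pull h : alg_morph h -> alg_morph (fun a : freealg K E =>
    h (api (nh_proper hN (R := R)) (api (@linear_rel_proper K E) a)) : B).
  move=> hm; apply: (alg_morph_comp (f := h \o _)) (alg_morph_api _).
  exact: alg_morph_comp hm (alg_morph_api _).
by apply: freealg_morph_eq => //; apply: pull.
Qed.

End NHomogeneousLift.
End AlgMorph.

(** * Independent families, bases and dual bases *)

(** Serves as a basis for the span of [s] when [V] may be infinite-dimensional. A vector of [s]
    joins the family only if it is not already a combination of it. *)
Lemma independent_family (K : fieldType) (V : lmodType K) (s : seq V) :
  exists m (w : 'I_m -> V),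
    (forall c : 'I_m -> K, \sum_i c i *: w i = 0 -> forall i, c i = 0)
    /\ {in s, forall v, exists c : 'I_m -> K, v = \sum_i c i *: w i}.
Proof.
elim: s => [|v s [m [w [wfree ws]]]].
  by exists 0, (fun=> 0); split=> [c _ []|].
have [vw|nvw] := pselect (exists c : 'I_m -> K, v = \sum_i c i *: w i).
  by exists m, w; split=> // u /[1!inE] /predU1P [->|/ws].
pose w' i := oapp w v (unlift ord0 i).
have w'E c : \sum_i c i *: w' i =
    c ord0 *: v + \sum_i c (lift ord0 i) *: w i.
  rewrite big_ord_recl /w' unlift_none; congr (_ + _).
  by apply: eq_bigr => i _; rewrite liftK.
exists m.+1, w'; split=> [c|u].
  (* A nonzero coefficient on [v] could be divided out, making [v] a combination of the [w i]. *)
  rewrite w'E => cw; have c0 : c ord0 = 0.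
    apply: contra_notP nvw => /eqP c0.
    exists (fun i => - (c ord0)^-1 * c (lift ord0 i)).
    apply: (scalerI c0); rewrite scaler_sumr.
    move/eqP: cw; rewrite addr_eq0 => /eqP ->; rewrite -sumrN.
    by apply: eq_bigr => i _; rewrite scalerA mulrA mulrN mulfV // mulN1r scaleNr.
  move: cw; rewrite c0 scale0r add0r => /wfree c'0 i.
  by case: (unliftP ord0 i) => [j|] ->.
rewrite inE => /predU1P [->|/ws [c ->]].
  exists (fun i => (i == ord0)%:R); rewrite w'E eqxx scale1r big1 ?addr0 // => i _.
  by rewrite scale0r.
exists (fun i => oapp c 0 (unlift ord0 i)).
rewrite w'E unlift_none scale0r add0r.
by apply: eq_bigr => i _; rewrite liftK.
Qed.

Section Basis.
Variables (K : fieldType) (E : vectType K) (n : nat) (X : n.-tuple E).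
Hypothesis Xbasis : basis_of fullv X.

Lemma dual_basisE i e : dual_basis X i e = coord X i e.
Proof. by rewrite /dual_basis lfunE. Qed.

Lemma dual_basis_delta (i j : 'I_n) : dual_basis X i X`_j = (i == j)%:R.
Proof. by rewrite dual_basisE coord_free 1?eq_sym //; apply: basis_free Xbasis. Qed.

Lemma basis_expansion e : e = \sum_(i < n) (dual_basis X i e : K) *: X`_i.
Proof.
rewrite {1}(coord_basis Xbasis (memvf e)).
by apply: eq_bigr => i _; rewrite dual_basisE.
Qed.

Lemma dual_basis_expansion (w : 'Hom(E, K^o)) :
  w = \sum_(i < n) (w X`_i : K) *: dual_basis X i.
Proof.
apply/lfunP => e; rewrite sum_lfunE {1}[e]basis_expansion linear_sum.
by apply: eq_bigr => i _; rewrite linearZ scale_lfunE; apply: mulrC.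
Qed.

Lemma multilinear_eq (N : nat) (U : lmodType K) (f g : {ffun 'I_N -> E} -> U) :
  is_multilinear f -> is_multilinear g ->
  (forall J : {ffun 'I_N -> 'I_n}, f [ffun i => X`_(J i)] = g [ffun i => X`_(J i)]) ->
  f =1 g.
Proof.
move=> fm gm fg t.
(* Induction on the number [k] of leading slots that are still arbitrary: the slots from [k] on hold
   basis vectors, and each step expands one more slot in the basis. At [k = N] the condition is
   empty. *)
suff h k (s : {ffun 'I_N -> E}) :
    (forall i : 'I_N, (k <= i)%N -> exists j : 'I_n, s i = X`_j) -> f s = g s.
  by apply: (h N) => i; rewrite leqNgt ltn_ord.
elim: k s => [|k IH] s sX.
  have /fin_all_exists [J sJ] i : exists j : 'I_n, s i = X`_j by apply: sX.
  rewrite (_ : s = [ffun i => X`_([ffun i => J i] i)]) ?fg //.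
  by apply/ffunP => i; rewrite !ffunE.
have [kN|Nk] := ltnP k N; last first.
  apply: IH => i ki; apply: sX; move: (ltn_ord i).
  by rewrite ltnNge (leq_trans Nk ki).
pose i0 := Ordinal kN.
have sE : s = upd s i0 (s i0).
  by apply/ffunP => i; rewrite ffunE; case: eqP => // ->.
rewrite sE [s i0]basis_expansion (lin_sum _ _ _ (fm s i0)) (lin_sum _ _ _ (gm s i0)).
apply: eq_bigr => j _; rewrite (lin_scale (fm s i0)) (lin_scale (gm s i0)).
congr (_ *: _); apply: IH => i ki; rewrite ffunE.
case: (eqVneq i i0) => [_|ii0]; first by exists j.
apply: sX; rewrite ltn_neqAle ki andbT eq_sym.
by apply: contraNneq ii0 => ik; apply/eqP/val_inj.
Qed.

Definition basis_tensor N (J : {ffun 'I_N -> 'I_n}) : tpow N E :=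
  tpow_pure [ffun i => X`_(J i)].

Definition dual_basis_tensor N (J : {ffun 'I_N -> 'I_n}) :
    tpow N 'Hom(E, K^o) := tpow_pure [ffun i => dual_basis X (J i)].

End Basis.

(** * Duality of tensor powers and the canonical element *)

Section Pairing.
Variables (K : fieldType) (N : nat) (E : vectType K).

Lemma tpow_pairing_bilinear : is_bilinear (@tpow_pairing K N E).
Proof.
apply: tpow_lift2_bilinear => [t' w' i a u v|w' t' i a u v];
  apply: (@prod_affine K N a i) => [|j ji|j ji];
  rewrite !ffunE ?eqxx ?(negPf ji) //.
- by rewrite add_lfunE scale_lfunE.
- by rewrite linearP.
Qed.

Lemma prod_delta n (I J : {ffun 'I_N -> 'I_n}) :
  \prod_i (I i == J i)%:R = (I == J)%:R :> K.
Proof.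
have [->|IJ] := eqVneq I J; first by rewrite big1 // => i _; rewrite eqxx.
have [i IJi] : exists i, I i != J i.
  apply/existsP; apply: contraNT IJ; rewrite negb_exists => /forallP IJ.
  by apply/eqP/ffunP => i; apply/eqP/negPn/IJ.
by rewrite (bigD1 i) //= (negPf IJi) mul0r.
Qed.

(** By multilinearity it is enough to treat basis tensors, whose pairings with the dual basis
    tensors are Kronecker deltas. *)
Lemma tpow_expansion n (X : n.-tuple E) : basis_of fullv X ->
  forall y : tpow N E, y = \sum_(J : {ffun 'I_N -> 'I_n})
    (tpow_pairing (dual_basis_tensor X J) y : K) *: basis_tensor X J.
Proof.
move=> Xb; pose f (y : tpow N E) := \sum_(J : {ffun 'I_N -> 'I_n})
  (tpow_pairing (dual_basis_tensor X J) y : K) *: basis_tensor X J.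
have pl J : linear (tpow_pairing (dual_basis_tensor X J) : tpow N E -> K^o).
  exact: tpow_pairing_bilinear.2.
have fl : linear f.
  move=> a x y; rewrite /f scaler_sumr -big_split; apply: eq_bigr => J _ /=.
  by rewrite pl scalerDl scalerA.
suff : id =1 f by [].
apply: tpow_eq => // t; suff : @tpow_pure K N E =1 f \o @tpow_pure K N E by [].
apply: (multilinear_eq Xb) => [|s i a u v|J].
- exact: tpow_pure_multilinear.
- by rewrite /= (tpow_pure_multilinear s i a u v) fl.
rewrite /= /f (bigD1 J) //= big1 => [|L LJ]; rewrite tpow_pairing_pure.
  rewrite (eq_bigr (fun i => (J i == J i)%:R)) => [|i _].
    by rewrite prod_delta eqxx scale1r addr0.
  by rewrite !ffunE dual_basis_delta.
rewrite (eq_bigr (fun i => (L i == J i)%:R)) => [|i _].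
  by rewrite prod_delta (negPf LJ) scale0r.
by rewrite !ffunE dual_basis_delta.
Qed.

Lemma tens_suml (V W : lmodType K) I (r : seq I) (F : I -> V) (w : W) :
  (\sum_(i <- r) F i) *t w = \sum_(i <- r) F i *t w.
Proof. exact: (lin_sum _ _ _ ((tpure_bilinear V W).1 w)). Qed.

Lemma tens_sumr (V W : lmodType K) I (r : seq I) (v : V) (F : I -> W) :
  v *t (\sum_(i <- r) F i) = \sum_(i <- r) v *t F i.
Proof. exact: (lin_sum _ _ _ ((tpure_bilinear V W).2 v)). Qed.

Lemma tens_scalel (V W : lmodType K) (a : K) (v : V) (w : W) :
  (a *: v) *t w = a *: (v *t w).
Proof. exact: (lin_scale ((tpure_bilinear V W).1 w)). Qed.

Lemma tens_scaler (V W : lmodType K) (a : K) (v : V) (w : W) :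
  v *t (a *: w) = a *: (v *t w).
Proof. exact: (lin_scale ((tpure_bilinear V W).2 v)). Qed.

(* Write the psi(e_J) in terms of linearly independent w_k.  As psi kills R,
   the coefficient of w_k, read as an element of the dual, lies in perp R. *)
Lemma canonical_tensor_vanish (R : {pred tpow N E}) n (X : n.-tuple E)
    (U V : lmodType K) (phi : tpow N 'Hom(E, K^o) -> U) (psi : tpow N E -> V) :
    basis_of fullv X -> linear phi -> linear psi ->
    (forall x, x \in perp R -> phi x = 0) -> (forall y, y \in R -> psi y = 0) ->
  \sum_(J : {ffun 'I_N -> 'I_n})
    phi (dual_basis_tensor X J) *t psi (basis_tensor X J) = 0.
Proof.
move=> Xb phil psil phi0 psi0.
have [m [w [wfree ws]]] := independent_family
  [seq psi (basis_tensor X J) | J : {ffun 'I_N -> 'I_n}].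
have /fin_all_exists [c psiE] (J : {ffun 'I_N -> 'I_n}) :
    exists c : 'I_m -> K, psi (basis_tensor X J) = \sum_k c k *: w k.
  exact/ws/image_f.
transitivity (\sum_k phi (\sum_J c J k *: dual_basis_tensor X J) *t w k).
  under eq_bigr do rewrite psiE tens_sumr.
  rewrite exchange_big; apply: eq_bigr => k _ /=.
  rewrite (lin_sum _ _ _ phil) tens_suml; apply: eq_bigr => J _.
  by rewrite tens_scaler (lin_scale phil) tens_scalel.
apply: big1 => k _; rewrite phi0; first by rewrite -(scale0r 0) tens_scalel scale0r.
apply/asboolP => y Ry; have pl := tpow_pairing_bilinear.1 y.
rewrite (lin_sum _ _ _ pl).
under eq_bigr do rewrite (lin_scale pl).
(* All [k] are treated at once: the pairings are the coefficients on the [w k] of [psi y], with [y]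
   expanded in the basis tensors, and [psi y = 0]. *)
move: k; apply: wfree; rewrite -[RHS](psi0 y Ry) [in RHS](tpow_expansion Xb y).
rewrite (lin_sum _ _ _ psil).
under [RHS]eq_bigr do rewrite (lin_scale psil) psiE scaler_sumr.
rewrite exchange_big. apply: eq_bigr => k _ /=; rewrite scaler_suml.
by apply: eq_bigr => J _; rewrite scalerA mulrC.
Qed.

(** Expand each [X_i] in [Y], exchange the sums, and recognise the dual basis of [Y] expanded in
    that of [X]. This lets a map built from one basis satisfy its defining formula for every
    basis. *)
Lemma canonical_tensor_basis n m (X : n.-tuple E) (Y : m.-tuple E)
    (U : lmodType K) (b : 'Hom(E, K^o) -> E -> U) :
    basis_of fullv X -> basis_of fullv Y -> is_bilinear b ->
  \sum_(i < n) b (dual_basis X i) X`_i = \sum_(j < m) b (dual_basis Y j) Y`_j.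
Proof.
move=> Xb Yb [bl br].
transitivity (\sum_(i < n) \sum_(j < m)
    (dual_basis Y j X`_i : K) *: b (dual_basis X i) Y`_j).
  apply: eq_bigr => i _; rewrite {1}[X`_i](basis_expansion Yb).
  rewrite (lin_sum _ _ _ (br _)); apply: eq_bigr => j _.
  by rewrite (lin_scale (br _)).
rewrite exchange_big; apply: eq_bigr => j _ /=.
rewrite [in RHS](dual_basis_expansion Xb (dual_basis Y j)).
rewrite (lin_sum _ _ _ (bl _)); apply: eq_bigr => i _.
by rewrite (lin_scale (bl _)).
Qed.

End Pairing.

(** * Bilinear maps and products of sums of pure tensors *)

Section BilinearTools.
Variable K : fieldType.

Lemma bilinear_tpow_eq (N : nat) (E E' U : lmodType K)
    (f g : tpow N E -> tpow N E' -> U) : is_bilinear f -> is_bilinear g ->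
    (forall t t', f (tpow_pure t) (tpow_pure t') = g (tpow_pure t) (tpow_pure t')) ->
  forall x y, f x y = g x y.
Proof.
move=> [fl fr] [gl gr] fg x y; move: x; apply: tpow_eq => // t.
by move: y; apply: tpow_eq.
Qed.

Lemma bilinear_comp_lin (V W U U' : lmodType K) (b : V -> W -> U) (f : U -> U') :
  is_bilinear b -> linear f -> is_bilinear (fun v w => f (b v w)).
Proof. by move=> [bl br] fl; split=> ?; apply: lin_comp. Qed.

Lemma bilinear_comp (V W V' W' U : lmodType K) (b : V' -> W' -> U)
    (f : V -> V') (g : W -> W') : is_bilinear b -> linear f -> linear g ->
  is_bilinear (fun v w => b (f v) (g w)).
Proof.
by move=> [bl br] fl gl; split=> [w|v];
  [apply: lin_comp (bl _) fl | apply: lin_comp (br _) gl].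
Qed.

Lemma lin_sum_fun (V U : lmodType K) (I : Type) (r : seq I) (f : I -> V -> U) :
  (forall i, linear (f i)) -> linear (fun x => \sum_(i <- r) f i x).
Proof.
move=> fl a x y; rewrite scaler_sumr -big_split; apply: eq_bigr => i _ /=.
exact: fl.
Qed.

Lemma bilinear_sum (V W U : lmodType K) (I : Type) (r : seq I)
    (b : I -> V -> W -> U) : (forall i, is_bilinear (b i)) ->
  is_bilinear (fun v w => \sum_(i <- r) b i v w).
Proof. by move=> bb; split=> ?; apply: lin_sum_fun => i; case: (bb i). Qed.

Lemma prod_tens (A B : algType K) I (r : seq I) (a : I -> A) (b : I -> B) :
  \prod_(i <- r) (a i *t b i) = (\prod_(i <- r) a i) *t (\prod_(i <- r) b i).
Proof.
elim: r => [|i r IH]; first by rewrite !big_nil.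
by rewrite !big_cons IH; apply: tmul_pure.
Qed.

Lemma prod_sum_tens (A B : algType K) N n (a : 'I_N -> 'I_n -> A)
    (b : 'I_N -> 'I_n -> B) :
  \prod_i \sum_j a i j *t b i j =
  \sum_(J : {ffun 'I_N -> 'I_n}) (\prod_i a i (J i)) *t (\prod_i b i (J i)).
Proof. by rewrite bigA_distr_bigA; apply: eq_bigr => J _; rewrite prod_tens. Qed.

End BilinearTools.

(** * Relations of the bullet product *)

Section Bullet.
Variables (K : fieldType) (N : nat) (E E' : lmodType K).

Lemma piN_linear : linear (@piN K N E E').
Proof.
apply/tlift_linear/tpow_lift2_bilinear => [t' t i a u v|t t' i a u v].
- have upE w : [ffun j => upd t i w j *t t' j] =
      upd [ffun j => t j *t t' j] i (w *t t' i).
    by apply/ffunP => j; rewrite !ffunE; case: eqVneq => // ->.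
  rewrite !upE ((tpure_bilinear E E').1 (t' i) a u v).
  exact: tpow_pure_multilinear.
- have upE w : [ffun j => t j *t upd t' i w j] =
      upd [ffun j => t j *t t' j] i (t i *t w).
    by apply/ffunP => j; rewrite !ffunE; case: eqVneq => // ->.
  rewrite !upE ((tpure_bilinear E E').2 (t i) a u v).
  exact: tpow_pure_multilinear.
Qed.

Variables (B : algType K) (f : tens E E' -> B).
Hypothesis fl : linear f.

Lemma mulmap_piN_bilinear :
  is_bilinear (fun (x : tpow N E) (y : tpow N E') => mulmap f (piN (x *t y))).
Proof.
have ml := lin_comp (mulmap_linear (N := N) fl) piN_linear.
exact: bilinear_comp_lin (tpure_bilinear _ _) ml.
Qed.

Lemma mulmap_piN_pure (t : {ffun 'I_N -> E}) (t' : {ffun 'I_N -> E'}) :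
  mulmap f (piN (tpow_pure t *t tpow_pure t')) = \prod_i f (t i *t t' i).
Proof.
by rewrite piN_pure mulmap_pure //; apply: eq_bigr => i _; rewrite ffunE.
Qed.

(** The relations are images under [piN] of a span of pure tensors, so linearity leaves only the
    tensors [x *t y]. *)
Lemma mulmap_bullet (R : {pred tpow N E}) (R' : {pred tpow N E'}) :
  (forall x y, x \in R -> y \in R' -> mulmap f (piN (x *t y)) = 0) ->
  forall z, z \in bullet_rel R R' -> mulmap f z = 0.
Proof.
move=> f0 z /asboolP [x /spanP + ->].
have ml := lin_comp (mulmap_linear (N := N) fl) piN_linear.
elim=> [|a _ v [u [w [uR wR' ->]]] _ IH]; first exact: lin0 ml.
by rewrite ml IH f0 // scaler0 addr0.
Qed.

End Bullet.


(** * Universal property and existence of the coproduct, coaction and counit *)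

Section Presentation.
Variables (K : fieldType) (N : nat).

(* The universal property of A(E, R).  Carrying it by an abstract algebra keeps
   the structures of the concrete quotient out of unification. *)
Definition presents (E : lmodType K) (R : {pred tpow N E}) (A : algType K)
    (gen : E -> A) : Prop :=
  [/\ linear gen, {in R, forall r, mulmap gen r = 0},
      forall (B : algType K) (f : E -> B), linear f ->
        {in R, forall r, mulmap f r = 0} ->
        exists g : {lrmorphism A -> B}, forall e, g (gen e) = f e
    & forall (B : algType K) (f g : A -> B), alg_morph f -> alg_morph g ->
        (forall e, f (gen e) = g (gen e)) -> f =1 g].

Lemma nhalg_presents (hN : (2 <= N)%N) (E : lmodType K) (R : {pred tpow N E}) :
  presents R (nhgen hN R).
Proof.
split; [exact: nhgen_linear | exact: mulmap_nhgen | exact: nhalg_lift |].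
exact: nhalg_morph_eq.
Qed.

Lemma presents_bullet (E E' : lmodType K) (R : {pred tpow N E})
    (R' : {pred tpow N E'}) (A : algType K) (gen : tens E E' -> A) x y :
  presents (bullet_rel R R') gen -> x \in R -> y \in R' ->
  mulmap gen (piN (x *t y)) = 0.
Proof.
move=> [_ gen0 _ _] xR yR'; apply/gen0/asboolP; exists (x *t y) => //.
by apply/spanP/in_span_sub; exists x, y.
Qed.

Lemma presents_bilinear (E E' : lmodType K) (R : {pred tpow N (tens E E')})
    (A : algType K) (gen : tens E E' -> A) :
  presents R gen -> is_bilinear (fun v w => gen (v *t w)).
Proof. by move=> [genl _ _ _]; apply: bilinear_comp_lin (tpure_bilinear _ _) genl. Qed.

Lemma vectType_basis (E : vectType K) :
  exists n (X : n.-tuple E), basis_of fullv X.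
Proof. by exists (\dim (@fullv K E)), (vbasis fullv); apply: vbasisP. Qed.

Lemma hom_coproduct_exists (E E' E'' : vectType K) (R : {pred tpow N E})
    (R' : {pred tpow N E'}) (R'' : {pred tpow N E''}) (H1 H2 H3 : algType K)
    (h1 : tens 'Hom(E, K^o) E' -> H1) (h2 : tens 'Hom(E', K^o) E'' -> H2)
    (h3 : tens 'Hom(E, K^o) E'' -> H3) :
    presents (bullet_rel (perp R) R') h1 ->
    presents (bullet_rel (perp R') R'') h2 ->
    presents (bullet_rel (perp R) R'') h3 ->
  exists Delta : {lrmorphism H3 -> tens H2 H1},
    forall n (X : n.-tuple E'), basis_of fullv X ->
    forall (w : 'Hom(E, K^o)) (e : E''), Delta (h3 (w *t e)) =
      \sum_(j < n) h2 (dual_basis X j *t e) *t h1 (w *t X`_j).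
Proof.
move=> p1 p2 [_ _ lift3 _].
have [n [X Xb]] := vectType_basis E'.
have h1b := presents_bilinear p1; have h2b := presents_bilinear p2.
have [h1l _ _ _] := p1; have [h2l _ _ _] := p2.
pose coprod w e := \sum_(j < n) h2 (dual_basis X j *t e) *t h1 (w *t X`_j).
have coprod_bil : is_bilinear coprod.
  apply: bilinear_sum => i; split=> [e|w].
    exact: lin_comp ((tpure_bilinear _ _).2 _) (h1b.1 _).
  exact: lin_comp ((tpure_bilinear _ _).1 _) (h2b.2 _).
have fl := tlift_linear coprod_bil.
(* Distributing the product of the [N] sums over [j] gives one sum over multi-indices [J], in which
   the two tensor factors multiply separately. *)
have mulmapE (x : tpow N 'Hom(E, K^o)) (y : tpow N E'') :
    mulmap (tlift coprod) (piN (x *t y)) =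
    \sum_(J : {ffun 'I_N -> 'I_n})
      mulmap h2 (piN (dual_basis_tensor X J *t y)) *t
      mulmap h1 (piN (x *t basis_tensor X J)).
  move: x y; apply: bilinear_tpow_eq => [||w t].
  - exact: mulmap_piN_bilinear.
  - apply: bilinear_sum => J; split=> [y|x].
      exact: lin_comp ((tpure_bilinear _ _).2 _) ((mulmap_piN_bilinear _ h1l).1 _).
    exact: lin_comp ((tpure_bilinear _ _).1 _) ((mulmap_piN_bilinear _ h2l).2 _).
  rewrite mulmap_piN_pure //.
  under eq_bigr do rewrite (tliftE _ _ coprod_bil).
  rewrite prod_sum_tens; apply: eq_bigr => J _.
  apply: f_equal2; rewrite (mulmap_piN_pure h2l, mulmap_piN_pure h1l).
    by apply: eq_bigr => i _; rewrite ffunE.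
  by apply: eq_bigr => i _; rewrite ffunE.
have [|Delta DeltaE] := lift3 _ _ fl.
  apply: mulmap_bullet => // x y xR yR''; rewrite mulmapE.
  (* With [x] and [y] fixed, the left factor kills [perp R'] because [y] lies in [R''], and the
     right factor kills [R'] because [x] lies in [perp R]. *)
  apply: (canonical_tensor_vanish (R := R')
    (phi := fun u => mulmap h2 (piN (u *t y)))
    (psi := fun v => mulmap h1 (piN (x *t v)))) => //.
  - exact: (mulmap_piN_bilinear _ h2l).1.
  - exact: (mulmap_piN_bilinear _ h1l).2.
  - by move=> u uR'; apply: presents_bullet p2 _ _.
  - by move=> v vR'; apply: presents_bullet p1 _ _.
exists Delta => m Y Yb w e; rewrite DeltaE (tliftE _ _ coprod_bil).
apply: (canonical_tensor_basis Xb Yb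
  (b := fun v e' => h2 (v *t e) *t h1 (w *t e'))).
exact: bilinear_comp (tpure_bilinear _ _) (h2b.1 _) (h1b.2 _).
Qed.

(** The argument for the coproduct with [A] as right factor: there [mulmap a] kills [R] directly,
    and the left factor kills [perp R] because [y] lies in [R']. *)
Lemma hom_coaction_exists (E E' : vectType K) (R : {pred tpow N E})
    (R' : {pred tpow N E'}) (H A B : algType K)
    (h : tens 'Hom(E, K^o) E' -> H) (a : E -> A) (b : E' -> B) :
    presents (bullet_rel (perp R) R') h -> presents R a -> presents R' b ->
  exists delta : {lrmorphism B -> tens H A},
    forall n (X : n.-tuple E), basis_of fullv X -> forall e' : E',
    delta (b e') = \sum_(i < n) h (dual_basis X i *t e') *t a X`_i.
Proof.
move=> ph [al a0 _ _] [_ _ liftB _].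
have [n [X Xb]] := vectType_basis E.
have hb := presents_bilinear ph; have [hl _ _ _] := ph.
pose coact (e' : E') := \sum_(i < n) h (dual_basis X i *t e') *t a X`_i.
have coactl : linear coact.
  apply: lin_sum_fun => i.
  exact: lin_comp ((tpure_bilinear _ _).1 _) (hb.2 _).
have mulmapE (y : tpow N E') : mulmap coact y =
    \sum_(J : {ffun 'I_N -> 'I_n})
      mulmap h (piN (dual_basis_tensor X J *t y)) *t mulmap a (basis_tensor X J).
  move: y; apply: tpow_eq => [||t].
  - exact: mulmap_linear.
  - apply: lin_sum_fun => J.
    exact: lin_comp ((tpure_bilinear _ _).1 _) ((mulmap_piN_bilinear _ hl).2 _).
  rewrite mulmap_pure // prod_sum_tens; apply: eq_bigr => J _.
  apply: f_equal2; rewrite (mulmap_piN_pure hl, mulmap_pure al).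
    by apply: eq_bigr => i _; rewrite ffunE.
  by apply: eq_bigr => i _; rewrite ffunE.
have [|delta deltaE] := liftB _ _ coactl.
  move=> y yR'; rewrite mulmapE.
  apply: (canonical_tensor_vanish (R := R)
    (phi := fun u => mulmap h (piN (u *t y)))) => //.
  - exact: (mulmap_piN_bilinear _ hl).1.
  - exact: mulmap_linear.
  - by move=> u uR; apply: presents_bullet ph _ _.
exists delta => m Y Yb e'; rewrite deltaE.
apply: (canonical_tensor_basis Xb Yb
  (b := fun w e => h (w *t e') *t a e)).
exact: bilinear_comp (tpure_bilinear _ _) (hb.1 _) al.
Qed.

(** The multiplicative extension of evaluation, composed with [piN], is the pairing of tensor
    powers, which vanishes between [perp R] and [R] by definition. *)
Lemma end_counit_exists (E : vectType K) (R : {pred tpow N E}) (H : algType K)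
    (h : tens 'Hom(E, K^o) E -> H) :
    presents (bullet_rel (perp R) R) h ->
  exists eps : {lrmorphism H -> K^o},
    forall (w : 'Hom(E, K^o)) (e : E), eps (h (w *t e)) = w e.
Proof.
move=> [_ _ liftH _]; pose ev (w : 'Hom(E, K^o)) (e : E) := w e.
have ev_bil : is_bilinear ev.
  split=> [e a u v|w a u v]; first by rewrite /ev add_lfunE scale_lfunE.
  exact: linearP.
have fl := tlift_linear ev_bil.
have [|eps epsE] := liftH (K^o : algType K) _ fl.
  apply: mulmap_bullet => // x y /asboolP xR yR; rewrite -[RHS](xR y yR).
  move: x y {xR yR}; apply: bilinear_tpow_eq => [||w t].
  - exact: mulmap_piN_bilinear.
  - exact: tpow_pairing_bilinear.
  rewrite mulmap_piN_pure // tpow_pairing_pure.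
  by apply: eq_bigr => i _; rewrite (tliftE _ _ ev_bil).
by exists eps => w e; rewrite epsE (tliftE _ _ ev_bil).
Qed.

End Presentation.

(** * Tensor products of morphisms, associativity and unit maps as algebra morphisms *)

Section TensorMorphisms.
Variable K : fieldType.

(** Both sides of multiplicativity are linear in each argument, so pure tensors suffice. *)
Lemma tlift_alg_morph (A B C : algType K) (f : A -> B -> C) :
    is_bilinear f -> f 1 1 = 1 ->
    (forall a a' b b', f (a * a') (b * b') = f a b * f a' b') ->
  alg_morph (tlift f).
Proof.
move=> fb f1 fM; have fl := tlift_linear fb; split=> //; split=> [|x y].
  by rewrite -f1; apply: tliftE.
have mulr_lin (z : C) : linear ( *%R^~ z : C -> C).
  by move=> c u v; rewrite mulrDl -scalerAl.
have mull_lin (z : C) : linear ( *%R z : C -> C).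
  by move=> c u v; rewrite mulrDr -scalerAr.
move: x; apply: tens_eq => [||a b].
- exact: lin_comp fl (tmul_linearl y).
- exact: lin_comp (mulr_lin _) fl.
move: y; apply: tens_eq => [||a' b'].
- exact: lin_comp fl (tmul_linearr _).
- exact: lin_comp (mull_lin _) fl.
rewrite (_ : (a *t b) * (a' *t b') = (a * a') *t (b * b')); last exact: tmul_pure.
by rewrite !tliftE.
Qed.

Section Map.
Variables (V V' W W' : lmodType K) (f : V -> V') (g : W -> W').
Hypotheses (fl : linear f) (gl : linear g).

Lemma tens_map_linear : linear (tens_map f g).
Proof. exact/tlift_linear/(bilinear_comp (tpure_bilinear _ _) fl gl). Qed.

Lemma tens_mapE v w : tens_map f g (v *t w) = f v *t g w.
Proof. exact: tliftE (bilinear_comp (tpure_bilinear _ _) fl gl). Qed.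

End Map.

Lemma tens_map_alg_morph (A A' B B' : algType K) (f : A -> A') (g : B -> B') :
  alg_morph f -> alg_morph g -> alg_morph (tens_map f g).
Proof.
move=> [fl [f1 fM]] [gl [g1 gM]]; apply: tlift_alg_morph.
- exact: bilinear_comp (tpure_bilinear _ _) fl gl.
- by rewrite f1 g1.
- by move=> a a' b b'; rewrite fM gM; apply/esym/tmul_pure.
Qed.

Section Assoc.
Variables U V W : lmodType K.

Let assoc_inner (w : W) (u : U) (v : V) := u *t (v *t w).

Fact assoc_inner_bilinear w : is_bilinear (assoc_inner w).
Proof.
split=> [v|u]; first exact: (tpure_bilinear _ _).1.
exact: lin_comp ((tpure_bilinear _ _).2 u) ((tpure_bilinear _ _).1 w).
Qed.

Fact assoc_innerE w u v : tlift (assoc_inner w) (u *t v) = u *t (v *t w).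
Proof. exact: tliftE (assoc_inner_bilinear w). Qed.

Fact tens_assoc_bilinear :
  is_bilinear (fun (x : tens U V) (w : W) => tlift (fun u v => u *t (v *t w)) x).
Proof.
split=> [w|x a w w']; first exact/tlift_linear/(assoc_inner_bilinear w).
move: x; apply: tens_eq => [||u v].
- exact/tlift_linear/(assoc_inner_bilinear _).
- by apply: lin_comb; apply/tlift_linear/(assoc_inner_bilinear _).
have hl := lin_comp ((tpure_bilinear U (tens V W)).2 u) ((tpure_bilinear V W).2 v).
apply: etrans (assoc_innerE _ u v) (etrans (hl a w w') _).
exact/esym/(f_equal2 (fun p q => a *: p + q)
  (assoc_innerE w u v) (assoc_innerE w' u v)).
Qed.

Lemma tens_assoc_linear : linear (@tens_assoc K U V W).
Proof. exact/tlift_linear/tens_assoc_bilinear. Qed.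

Lemma tens_assocE (u : U) (v : V) (w : W) : tens_assoc (u *t v *t w) = u *t (v *t w).
Proof.
rewrite /tens_assoc (tliftE _ _ tens_assoc_bilinear).
exact: assoc_innerE.
Qed.

End Assoc.

Lemma tens_assoc_alg_morph (A B C : algType K) : alg_morph (@tens_assoc K A B C).
Proof.
apply: tlift_alg_morph => [||x x' c c']; first exact: tens_assoc_bilinear.
  exact: assoc_innerE.
have il c0 := tlift_linear (@assoc_inner_bilinear A B C c0).
move: x; apply: tens_eq => [||a b].
- exact: lin_comp (il _) (tmul_linearl x').
- exact: lin_comp (tmul_linearl _) (il _).
move: x'; apply: tens_eq => [||a' b'].
- exact: lin_comp (il _) (tmul_linearr _).
- exact: lin_comp (tmul_linearr _) (il _).
rewrite (_ : (a *t b) * (a' *t b') = (a * a') *t (b * b')); last exact: tmul_pure.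
apply: esym.
apply: etrans (f_equal2 *%R (assoc_innerE c a b) (assoc_innerE c' a' b')) _.
apply: etrans (tmul_pure _ _ _ _) _.
apply: etrans (f_equal (tpure (a * a')) (tmul_pure _ _ _ _)) _.
exact/esym/assoc_innerE.
Qed.

Lemma unitl_bilinear (V : lmodType K) :
  is_bilinear (fun (a : K^o) (v : V) => (a : K) *: v).
Proof.
split=> [v c a b|a c v w]; first by rewrite scalerDl scalerA.
by rewrite scalerDr !scalerA mulrC.
Qed.

Lemma unitr_bilinear (V : lmodType K) :
  is_bilinear (fun (v : V) (a : K^o) => (a : K) *: v).
Proof. by split=> ?; [apply: (unitl_bilinear V).2 | apply: (unitl_bilinear V).1]. Qed.

Lemma tens_unitl_linear (V : lmodType K) : linear (@tens_unitl K V).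
Proof. exact/tlift_linear/unitl_bilinear. Qed.

Lemma tens_unitr_linear (V : lmodType K) : linear (@tens_unitr K V).
Proof. exact/tlift_linear/unitr_bilinear. Qed.

Lemma tens_unitl_alg_morph (A : algType K) : alg_morph (@tens_unitl K A).
Proof.
apply: tlift_alg_morph => [||a a' b b']; first exact: unitl_bilinear.
  exact: scale1r.
by rewrite -scalerAl -scalerAr scalerA.
Qed.

Lemma tens_unitr_alg_morph (A : algType K) : alg_morph (@tens_unitr K A).
Proof.
apply: tlift_alg_morph => [||a a' b b']; first exact: unitr_bilinear.
  exact: scale1r.
by rewrite -scalerAl -scalerAr scalerA.
Qed.

End TensorMorphisms.

(** * Bialgebra and comodule laws *)

Section EndBialgebra.
Variables (K : fieldType) (N : nat) (E : vectType K).
Variables (H : algType K) (h : tens 'Hom(E, K^o) E -> H).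
Variables (Delta : {lrmorphism H -> tens H H}) (eps : {lrmorphism H -> K^o}).
Variables (n : nat) (X : n.-tuple E).
Hypothesis Xb : basis_of fullv X.
Hypothesis DeltaE : forall (w : 'Hom(E, K^o)) (e : E), Delta (h (w *t e)) =
  \sum_(j < n) h (dual_basis X j *t e) *t h (w *t X`_j).
Hypothesis epsE : forall (w : 'Hom(E, K^o)) (e : E), eps (h (w *t e)) = w e.

Let Delta_alg := alg_morph_lrmorphism Delta.
Let eps_alg := alg_morph_lrmorphism eps.

(* Used with M = A and with M = H, a e = h (w *t e), for a fixed w. *)
Section Coaction.
Variables (M : lmodType K) (a : E -> M) (delta : M -> tens H M).
Hypotheses (al : linear a) (dl : linear delta).
Hypothesis deltaE : forall e,
  delta (a e) = \sum_(i < n) h (dual_basis X i *t e) *t a X`_i.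

(** Both sides are the double sum of [h (e^j *t e) *t (h (e^i *t e_j) *t a e_i)], where [e_i] is the
    basis [X] and [e^i] its dual; only the order of summation differs. *)
Lemma coaction_coassoc e : tens_assoc (tens_map Delta id (delta (a e))) =
                           tens_map id delta (delta (a e)).
Proof.
have idl (V : lmodType K) : linear (@id V) by [].
rewrite deltaE (lin_sum _ _ _ (tens_map_linear Delta_alg.1 (idl M))).
rewrite (lin_sum _ _ _ (@tens_assoc_linear K H H M)).
rewrite (lin_sum _ _ _ (tens_map_linear (idl H) dl)).
under eq_bigr => i _.
  rewrite (tens_mapE Delta_alg.1 (idl M)) DeltaE tens_suml.
  rewrite (lin_sum _ _ _ (@tens_assoc_linear K H H M)).
  under eq_bigr do rewrite tens_assocE.
  over.
rewrite exchange_big; apply: eq_bigr => j _ /=.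
by rewrite (tens_mapE (idl H) dl) deltaE tens_sumr.
Qed.

(** The counit turns the left factors into the coordinates of [e], so this is [a] applied to the
    basis expansion of [e]. *)
Lemma coaction_counit e : tens_unitl (tens_map eps id (delta (a e))) = a e.
Proof.
have idl : linear (@id M) by [].
rewrite deltaE (lin_sum _ _ _ (tens_map_linear eps_alg.1 idl)).
rewrite (lin_sum _ _ _ (@tens_unitl_linear K M)).
rewrite {2}[e](basis_expansion Xb) (lin_sum _ _ _ al).
apply: eq_bigr => i _; rewrite (tens_mapE eps_alg.1 idl) epsE (lin_scale al).
exact: (tliftE _ _ (unitl_bilinear M)).
Qed.

End Coaction.

(** On the right factor the counit yields the values of [w] on the basis, so here it is [w] that is
    expanded, in the dual basis. *)
Lemma coproduct_counitr (w : 'Hom(E, K^o)) e : linear h ->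
  tens_unitr (tens_map id eps (Delta (h (w *t e)))) = h (w *t e).
Proof.
move=> hl; have idl : linear (@id H) by [].
have hwl := lin_comp hl ((tpure_bilinear 'Hom(E, K^o) E).1 e).
rewrite DeltaE (lin_sum _ _ _ (tens_map_linear idl eps_alg.1)).
rewrite (lin_sum _ _ _ (@tens_unitr_linear K H)).
apply: etrans (esym (congr1 (fun v => h (v *t e)) (dual_basis_expansion Xb w))).
apply: etrans (esym (lin_sum _ _ _ hwl)).
apply: eq_bigr => i _; rewrite (tens_mapE idl eps_alg.1) epsE.
apply: etrans (tliftE _ _ (unitr_bilinear H)) _.
exact: esym (lin_scale hwl _ _).
Qed.

End EndBialgebra.

Lemma end_bialgebra (K : fieldType) (N : nat) (E : vectType K)
    (R : {pred tpow N E}) (H A : algType K) (h : tens 'Hom(E, K^o) E -> H)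
    (a : E -> A) :
    presents (bullet_rel (perp R) R) h -> presents R a ->
  exists (Delta : {lrmorphism H -> tens H H}) (eps : {lrmorphism H -> K^o})
         (delta : {lrmorphism A -> tens H A}),
    [/\ forall n (X : n.-tuple E), basis_of fullv X ->
          forall (w : 'Hom(E, K^o)) (e : E), Delta (h (w *t e)) =
            \sum_(j < n) h (dual_basis X j *t e) *t h (w *t X`_j),
        forall (w : 'Hom(E, K^o)) (e : E), eps (h (w *t e)) = w e,
        forall n (X : n.-tuple E), basis_of fullv X -> forall e : E,
          delta (a e) = \sum_(i < n) h (dual_basis X i *t e) *t a X`_i,
        is_bialgebra Delta eps
      & is_left_comodule Delta eps delta].
Proof.
move=> ph pa.
have [Delta DeltaE] := hom_coproduct_exists ph ph ph.
have [eps epsE] := end_counit_exists ph.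
have [delta deltaE] := hom_coaction_exists ph pa pa.
exists Delta, eps, delta.
have [n [X Xb]] := vectType_basis E.
have DeltaE' := DeltaE n X Xb; have deltaE' := deltaE n X Xb.
have [hl _ _ H_eq] := ph; have [al _ _ A_eq] := pa.
have Dm := alg_morph_lrmorphism Delta; have em := alg_morph_lrmorphism eps.
have dm := alg_morph_lrmorphism delta.
have idm (B : algType K) : alg_morph (@id B) by [].
have hwl w := lin_comp hl ((tpure_bilinear 'Hom(E, K^o) E).2 w).
(* The generators of [H] are indexed by all of [E^* (x) E]; linearity cuts them down to pure
   tensors. *)
have H_eqP (B : algType K) (f g : H -> B) : alg_morph f -> alg_morph g ->
    (forall w e, f (h (w *t e)) = g (h (w *t e))) -> f =1 g.
  move=> fm gm fg; apply: H_eq => //.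
  by apply: tens_eq => //; apply: lin_comp hl; [exact: fm.1 | exact: gm.1].
split=> //; first split.
- apply: H_eqP => [||w e].
  + apply: alg_morph_comp (tens_assoc_alg_morph H H H) _.
    exact: alg_morph_comp (tens_map_alg_morph Dm (idm H)) Dm.
  + exact: alg_morph_comp (tens_map_alg_morph (idm H) Dm) Dm.
  (* For fixed [w], the formula for [Delta] has the shape of a coaction on the elements
     [h (w *t e)], so coassociativity is an instance of the coaction law. *)
  exact: (coaction_coassoc DeltaE' Dm.1 (DeltaE' w)).
- apply: H_eqP => [||w e] //.
  + apply: alg_morph_comp (tens_unitl_alg_morph H) _.
    exact: alg_morph_comp (tens_map_alg_morph em (idm H)) Dm.
  exact: (coaction_counit Xb epsE (hwl w) (DeltaE' w)).
- apply: H_eqP => [||w e] //.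
  + apply: alg_morph_comp (tens_unitr_alg_morph H) _.
    exact: alg_morph_comp (tens_map_alg_morph (idm H) em) Dm.
  exact: (coproduct_counitr Xb DeltaE' epsE).
split.
- apply: A_eq => [||e].
  + apply: alg_morph_comp (tens_assoc_alg_morph H H A) _.
    exact: alg_morph_comp (tens_map_alg_morph Dm (idm A)) dm.
  + exact: alg_morph_comp (tens_map_alg_morph (idm H) dm) dm.
  exact: (coaction_coassoc DeltaE' dm.1 deltaE').
apply: A_eq => [||e] //.
  apply: alg_morph_comp (tens_unitl_alg_morph A) _.
  exact: alg_morph_comp (tens_map_alg_morph em (idm A)) dm.
exact: (coaction_counit Xb epsE al deltaE').
Qed.

Theorem theorem3 (K : fieldType) (N : nat) (hN : (2 <= N)%N) (E : vectType K)
    (R : {pred tpow N E}) (hR : submod_closed R) :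
  exists (Delta : {lrmorphism homalg hN R R ->
                     tens (homalg hN R R) (homalg hN R R)})
         (eps : {lrmorphism homalg hN R R -> K^o})
         (delta : {lrmorphism nhalg hN R -> tens (homalg hN R R) (nhalg hN R)}),
    [/\ is_hom_coproduct Delta,
        forall (w : 'Hom(E, K^o)) (e : E), eps (homgen hN R R w e) = w e,
        is_hom_coaction delta,
        is_bialgebra Delta eps
      & is_left_comodule Delta eps delta].
Proof.
(* [homgen] unfolds to [nhgen] at [w *t e], so the formulas required of the structure maps agree
   with the general ones by conversion. *)
exact (end_bialgebra (nhalg_presents hN (bullet_rel (perp R) R))
         (nhalg_presents hN R)).
Qed.
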